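(* Let $q$ be odd. Let $\mathcal R$ be the following set of relations in letters $\mathbf s,\mathbf t,\mathbf z,\mathbf d,\mathbf D,\mathbf u$ (which constitute a presentation for $\mathrm{SU}(4,q)/\langle-I_4\rangle$): - $\mathbf u^2=1$; $[\mathbf d,\mathbf D]=1$; $\mathbf D^{q+1}=\mathbf d\,\mathbf d^{-\mathbf u}$; $[\mathbf z,\mathbf z^{\mathbf u}]=1$; $\mathbf d=[\mathbf D^{-1},\mathbf z]$; $[\mathbf d,\mathbf z^{\mathbf u}]=1$; - $\mathbf s$ is centralised by $\mathbf D^{(q+1)/2}\mathbf d^{-1}$ and $\mathbf z\mathbf u\mathbf z^{-1}$; $\mathbf t$ is centralised by $\mathbf d^{\mathbf u}$, $\mathbf z^{\mathbf u}$ and $\mathbf D^2\mathbf d^{-1}$; - relations that present $\mathrm{SL}(2,q)$ on $\{\mathbf t,\mathbf d,\mathbf z\}$, and $\mathrm{PSL}(2,q^2)$ on $\{\mathbf s,\mathbf D,\mathbf u\mathbf z^2\}$; - $[\mathbf s,\mathbf t]=1$; $[\mathbf s,\mathbf s^{\mathbf z}]=\mathbf t^{2\mathbf z\mathbf u}$; $[\mathbf s^{\mathbf D},\mathbf s^{\mathbf z}]=\mathbf t^{\mathbf z\mathbf u\mathbf D^m}$ where $\omega_0^m=\omega^2+\omega^{2q}$ (with right-hand side replaced by $1$ if $q=3$); $[\mathbf s,\mathbf t^{\mathbf z}]=\mathbf s^{\mathbf z}\mathbf t^{-\mathbf z\mathbf u}$; $[\mathbf t,\mathbf t^{\mathbf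 u}]=1$; - if $q=3$, $\mathbf t=[\mathbf s^{-\mathbf u\mathbf z},\mathbf s]^{\mathbf D}$. Then a presentation for $\Omega^-(6,q)$ on the generators $\{\sigma,\tau,\delta,z,U'\}$ is given by the relations obtained from $\mathcal R$ by the substitutions $$\mathbf s\mapsto\tau^{-1},\quad \mathbf t\mapsto\sigma,\quad \mathbf z\mapsto U',\quad \mathbf d\mapsto\delta\delta^{-U'},\quad \mathbf D\mapsto\delta,\quad \mathbf u\mapsto zU'^2.$$
   Context: Conventions: $x^y=y^{-1}xy$, $[x,y]=x^{-1}y^{-1}xy$, $x^{ky}=(x^k)^y$ and $x^{-y}=(x^{-1})^y$ for $k$ an integer and $x,y$ group elements. Linear maps act on the right and fix unmentioned basis vectors. ''Relations that present $H$ on given letters'' means any set of relators whose normal closure in the free group on those letters is the kernel of the map onto $H$ sending the letters to the indicated elements of $H$: for $\{\mathbf t,\mathbf d,\mathbf z\}$ these are $\begin{pmatrix}1&1\\0&1\end{pmatrix}$, $\begin{pmatrix}\omega_0^{-1}&0\\0&\omega_0\end{pmatrix}$, $\begin{pmatrix}0&1\\-1&0\end{pmatrix}$ in $\mathrm{SL}(2,q)$; for $\{\mathbf s,\mathbf D,\mathbf u\mathbf z^2\}$ they are the images in $\mathrm{PSL}(2,q^2)$ of $\begin{pmatrix}1&1\\0&1\end{pmatrix}$, $\begin{pmatrix}\omega^{-1}&0\\0&\omega\end{pmatrix}$, $\begin{pmatrix}0&1\\-1&0\end{pmatrix}$. Here $\omega$ is a primitive element of $\mathrm{GF}(q^2)$,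 $\omega_0=\omega^{q+1}$, $\psi=\omega^{(q+1)/2}$. The natural module of $\Omega^-(6,q)$ over $\mathrm{GF}(q)$ has basis $(e_1,f_1,e_2,f_2,w_1,w_2)$ with symmetric bilinear form $e_i.f_i=f_i.e_i=1$, $w_1.w_1=-2$, $w_2.w_2=2\omega_0$, all other products zero. With $A=(\omega^{q-1}+\omega^{1-q})/2$, $B=\psi(\omega^{1-q}-\omega^{q-1})/2$, $C=\psi^{-1}(\omega^{1-q}-\omega^{q-1})/2$, the generators are the matrices $\sigma=(e_1\mapsto e_1+e_2,\ f_2\mapsto f_2-f_1)$; $\tau=(e_1\mapsto e_1+f_1+w_1,\ w_1\mapsto w_1+2f_1)$; $\delta=(e_1\mapsto\omega_0^{-1}e_1,\ f_1\mapsto\omega_0f_1,\ w_1\mapsto Aw_1-Cw_2,\ w_2\mapsto-Bw_1+Aw_2)$; $z=(e_1\mapsto f_1,\ f_1\mapsto e_1,\ w_1\mapsto-w_1)$; $U'=(e_1\mapsto e_2,\ e_2\mapsto-e_1,\ f_1\mapsto f_2,\ f_2\mapsto-f_1)$. In $\mathrm{SU}(4,q)$, with hyperbolic basis $(e_1,f_1,e_2,f_2)$ (hermitian form $e_i.f_i=f_i.e_i=1$, others zero), the letters stand for $\mathbf s=(e_1\mapsto e_1+e_2,\ f_2\mapsto f_2-f_1)$, $\mathbf t=(e_1\mapsto e_1-\psi f_1)$, $\mathbf z=(e_1\mapsto-\psi f_1,\ f_1\mapsto\psi^{-1}e_1)$, $\mathbf d=(e_1\mapsto\omega_0^{-1}e_1,\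 f_1\mapsto\omega_0f_1)$, $\mathbf D=(e_1\mapsto\omega^{-1}e_1,\ f_1\mapsto\omega^qf_1,\ e_2\mapsto\omega e_2,\ f_2\mapsto\omega^{-q}f_2)$, and $\mathbf u$ interchanging $e_1,e_2$ and $f_1,f_2$. *)

(* Defs.v *)
From HB Require Import structures.
From mathcomp Require Import all_boot all_order all_fingroup all_algebra.
From mathcomp Require Import all_solvable all_field.

Set Implicit Arguments.
Unset Strict Implicit.
Unset Printing Implicit Defensive.

Import GroupScope.

(* The free group on X: reduced words in the signed letters (x, b), where     *)
(* (x, false) stands for x and (x, true) for its inverse.                     *)

Section FreeGroup.
Variable X : choiceType.
Implicit Types (a b : X * bool) (s u v : seq (X * bool)).

Definition linv a := (a.1, ~~ a.2).

Definition reduced s := sorted (fun a b => b != linv a) s.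

Definition rcons_red a s :=
  if s is b :: s' then if b == linv a then s' else a :: s else [:: a].

Definition reduce s := foldr rcons_red [::] s.

Lemma linvK : involutive linv.
Proof. by case=> x b; rewrite /linv /= negbK. Qed.

Lemma reduced_tail a s : reduced (a :: s) -> reduced s.
Proof. by case: s => //= b s /andP[]. Qed.

Lemma rcons_red_reduced a s : reduced s -> reduced (rcons_red a s).
Proof.
case: s => //= b s Hs; case: eqP => [_|/eqP nba] /=; first exact: reduced_tail Hs.
by rewrite nba.
Qed.

Lemma foldr_reduced s u : reduced s -> reduced (foldr rcons_red s u).
Proof. by move=> Hs; elim: u => //= a u; apply: rcons_red_reduced. Qed.

Lemma reduce_reduced s : reduced (reduce s).
Proof. exact: foldr_reduced. Qed.

Lemma reduce_id s : reduced s -> reduce s = s.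
Proof.
elim: s => //= a s IHs Has; have Hs := reduced_tail Has.
rewrite {}IHs //; case: s Has {Hs} => //= b s /andP[nba _].
by rewrite (negPf nba).
Qed.

Lemma rcons_redK a s : reduced s -> rcons_red (linv a) (rcons_red a s) = s.
Proof.
case: s => [_|b s] /=; first by rewrite linvK eqxx.
case: eqP => [-> | _ _] /=; last by rewrite linvK eqxx.
case: s => //= c s /andP[nca _].
by rewrite (negPf nca).
Qed.

Lemma foldr_rcons_red a s u : reduced s -> reduced u ->
  foldr rcons_red s (rcons_red a u) = rcons_red a (foldr rcons_red s u).
Proof.
move=> Hs; case: u => //= b u Hu; case: eqP => //= ->.
by rewrite -{1}(linvK a) rcons_redK // foldr_reduced.
Qed.

Lemma foldr_reduce s u : reduced s ->
  foldr rcons_red s (reduce u) = foldr rcons_red s u.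
Proof.
move=> Hs; elim: u => //= a u IHu.
by rewrite foldr_rcons_red ?reduce_reduced ?IHu.
Qed.

Lemma reduce_cat u v : reduce (u ++ v) = reduce (reduce u ++ v).
Proof. by rewrite /reduce !foldr_cat foldr_reduce // reduce_reduced. Qed.

Lemma reduce_catr u v : reduce (u ++ v) = reduce (u ++ reduce v).
Proof.
rewrite /reduce !foldr_cat -![foldr _ [::] _]/(reduce _).
by rewrite (reduce_id (reduce_reduced v)).
Qed.

Record freegroup := FreeGroup {fgword :> seq (X * bool); _ : reduced fgword}.

HB.instance Definition _ := [isSub for fgword].
HB.instance Definition _ := [Choice of freegroup by <:].

Implicit Types x y z : freegroup.

Definition fg_of s := FreeGroup (reduce_reduced s).
Definition fg_one := fg_of [::].
Definition fg_mul x y := fg_of (x ++ y).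
Definition fg_inv x := fg_of (rev (map linv x)).

Lemma fgP x : reduced x. Proof. exact: valP. Qed.

Lemma fg_mulA : associative fg_mul.
Proof.
by move=> x y z; apply: val_inj; rewrite /= -reduce_catr -reduce_cat catA.
Qed.

Lemma fg_mul1 : left_id fg_one fg_mul.
Proof. by move=> x; apply: val_inj; rewrite /= reduce_id ?fgP. Qed.

Lemma fg_1mul : right_id fg_one fg_mul.
Proof. by move=> x; apply: val_inj; rewrite /= cats0 reduce_id ?fgP. Qed.

Lemma reduce_catVs s : reduce (rev (map linv s) ++ s) = [::].
Proof.
elim: s => //= a s IHs; rewrite rev_cons cat_rcons reduce_catr /=.
by rewrite rcons_redK ?reduce_reduced // -reduce_catr.
Qed.

Lemma fg_mulV : left_inverse fg_one fg_inv fg_mul.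
Proof. by move=> x; apply: val_inj; rewrite /= -reduce_cat reduce_catVs. Qed.

Lemma fg_Vmul : right_inverse fg_one fg_inv fg_mul.
Proof.
move=> x; apply: val_inj; rewrite /= -reduce_catr.
rewrite -[X in X ++ _](mapK linvK) -[X in X ++ _]revK -map_rev.
exact: reduce_catVs.
Qed.

HB.instance Definition _ :=
  isGroup.Build freegroup fg_mulA fg_mul1 fg_1mul fg_mulV fg_Vmul.

Definition fggen (x : X) : freegroup := fg_of [:: (x, false)].

End FreeGroup.

(* The homomorphism from the free group on 'I_n sending letter i to xs_i.     *)
Definition fgeval (G : groupType) n (xs : n.-tuple G) (w : freegroup 'I_n) : G :=
  \prod_(a <- fgword w) (if a.2 then (tnth xs a.1)^-1 else tnth xs a.1).

Definition letters n : n.-tuple (freegroup 'I_n) := [tuple fggen i | i < n].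

Inductive normal_closure (G : groupType) (R : G -> Prop) : G -> Prop :=
  | NclRel r of R r : normal_closure R r
  | NclOne : normal_closure R 1
  | NclMul x y of normal_closure R x & normal_closure R y :
      normal_closure R (x * y)
  | NclInv x of normal_closure R x : normal_closure R x^-1
  | NclConj x y of normal_closure R x : normal_closure R (x ^ y).

Definition image_rel (G H : Type) (f : G -> H) (R : G -> Prop) (y : H) : Prop :=
  exists2 x, R x & y = f x.

(* <letters | R> is a presentation of G when letter i is read as xs_i. *)
Definition presents n (R : freegroup 'I_n -> Prop)
    (gT : finGroupType) (G : {set gT}) (xs : n.-tuple gT) : Prop :=
  <<[set:: xs]>> = G /\
  forall w : freegroup 'I_n, fgeval xs w = 1 <-> normal_closure R w.

Definition expgz (G : groupType) (x : G) (m : int) : G :=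
  match m with Posz n => x ^+ n | Negz n => x ^- n.+1 end.

Definition relator (G : groupType) (x y : G) : G := x * y^-1.

(* The relators of R that do not involve the presentations of SL(2,q) and     *)
(* PSL(2,q^2).                                                                *)
Definition explicit_relators (G : groupType) (q : nat) (m : int)
    (s t z d D u : G) : seq G :=
  [:: u ^+ 2;
      [~ d, D];
      relator (D ^+ q.+1) (d * (d^-1) ^ u);
      [~ z, z ^ u];
      relator d [~ D^-1, z];
      [~ d, z ^ u];
      [~ s, D ^+ (q.+1)./2 * d^-1];
      [~ s, z * u * z^-1];
      [~ t, d ^ u];
      [~ t, z ^ u];
      [~ t, D ^+ 2 * d^-1];
      [~ s, t];
      relator [~ s, s ^ z] ((t ^+ 2) ^ (z * u));
      relator [~ s ^ D, s ^ z]
              (if q == 3 then 1 else t ^ (z * u * expgz D m));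
      relator [~ s, t ^ z] (s ^ z * (t^-1) ^ (z * u));
      [~ t, t ^ u]]
  ++ (if q == 3 then [:: relator t ([~ (s^-1) ^ (u * z), s] ^ D)] else [::]).

(* R, in the letters s, t, z, d, D, u in this order.  RSL is a set of         *)
(* relators in t, d, z and RPSL a set of relators in s, D, uz^2.              *)
Definition SU4_relators (q : nat) (m : int)
    (RSL RPSL : freegroup 'I_3 -> Prop) (w : freegroup 'I_6) : Prop :=
  let l i := tnth (letters 6) (inord i) in
  let s := l 0%N in let t := l 1%N in let z := l 2%N in
  let d := l 3%N in let D := l 4%N in let u := l 5%N in
  [\/ w \in explicit_relators q m s t z d D u,
      image_rel (fgeval [tuple t; d; z]) RSL w
    | image_rel (fgeval [tuple s; D; u * z ^+ 2]) RPSL w].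

(* The substitution, from words in s, t, z, d, D, u to words in sigma, tau,   *)
(* delta, z, U'.                                                              *)
Definition subst : freegroup 'I_6 -> freegroup 'I_5 :=
  let l i := tnth (letters 5) (inord i) in
  let sigma := l 0%N in let tau := l 1%N in let delta := l 2%N in
  let z := l 3%N in let U' := l 4%N in
  fgeval [tuple tau^-1; sigma; U'; delta * (delta^-1) ^ U'; delta;
                z * U' ^+ 2].

Local Open Scope ring_scope.

(* Matrices are given by their rows, the images of the basis vectors (linear  *)
(* maps act on the right).                                                    *)
Definition mxrows (R : nzRingType) n (rows : seq (seq R)) : 'M[R]_n :=
  \matrix_(i, j) (nth [::] rows i)`_j.

(* All the matrices to which this is applied are invertible, so that the      *)
(* default value 1 is not used.                                               *)
Definition GLrows (R : finComUnitRingType) n (rows : seq (seq R)) :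
  {'GL_n[R]} := insubd (1%g : {'GL_n[R]}) (mxrows n.-1.+1 rows).

Section LinearGroups.
Variable F : finFieldType.

Definition SL2 : {set {'GL_2[F]}} := [set g | \det (GLval g) == 1].

(* w is a generator of the multiplicative group of F. *)
Definition primitive_element (w : F) := (#|F|.-1).-primitive_root w.

Definition SL2_gens (w : F) : 3.-tuple {'GL_2[F]} :=
  [tuple GLrows 2 [:: [:: 1; 1]; [:: 0; 1]];
         GLrows 2 [:: [:: w^-1; 0]; [:: 0; w]];
         GLrows 2 [:: [:: 0; 1]; [:: -1; 0]]].

Definition PSL2 : {set coset_of 'Z(SL2)} := (SL2 / 'Z(SL2))%g.

Definition PSL2_gens (w : F) : 3.-tuple (coset_of 'Z(SL2)) :=
  [tuple of map (coset 'Z(SL2)) (SL2_gens w)].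

End LinearGroups.

Section Unitary.
(* F is GF(q^2). *)
Variables (q : nat) (F : finFieldType).

(* The hermitian form in the basis e1, f1, e2, f2. *)
Definition hermitian_form : 'M[F]_4 :=
  mxrows 4 [:: [:: 0; 1; 0; 0]; [:: 1; 0; 0; 0];
               [:: 0; 0; 0; 1]; [:: 0; 0; 1; 0]].

Definition SU4 : {set {'GL_4[F]}} :=
  [set g : {'GL_4[F]} |
    (GLval g *m hermitian_form *m (map_mx (fun x => x ^+ q) (GLval g))^T
       == hermitian_form)
    && (\det (GLval g) == 1)].

Definition negI4 : {'GL_4[F]} :=
  GLrows 4 [:: [:: -1; 0; 0; 0]; [:: 0; -1; 0; 0];
               [:: 0; 0; -1; 0]; [:: 0; 0; 0; -1]].

Definition SU4_mod : {set coset_of <[negI4]>} := (SU4 / <[negI4]>)%g.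

(* The letters s, t, z, d, D, u; w is a primitive element of F. *)
Definition SU4_gens (w : F) : 6.-tuple {'GL_4[F]} :=
  let w0 := w ^+ q.+1 in
  let psi := w ^+ (q.+1)./2 in
  [tuple
    GLrows 4 [:: [:: 1; 0; 1; 0]; [:: 0; 1; 0; 0];
                 [:: 0; 0; 1; 0]; [:: 0; -1; 0; 1]];
    GLrows 4 [:: [:: 1; - psi; 0; 0]; [:: 0; 1; 0; 0];
                 [:: 0; 0; 1; 0]; [:: 0; 0; 0; 1]];
    GLrows 4 [:: [:: 0; - psi; 0; 0]; [:: psi^-1; 0; 0; 0];
                 [:: 0; 0; 1; 0]; [:: 0; 0; 0; 1]];
    GLrows 4 [:: [:: w0^-1; 0; 0; 0]; [:: 0; w0; 0; 0];
                 [:: 0; 0; 1; 0]; [:: 0; 0; 0; 1]];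
    GLrows 4 [:: [:: w^-1; 0; 0; 0]; [:: 0; w ^+ q; 0; 0];
                 [:: 0; 0; w; 0]; [:: 0; 0; 0; w ^- q]];
    GLrows 4 [:: [:: 0; 0; 1; 0]; [:: 0; 0; 0; 1];
                 [:: 1; 0; 0; 0]; [:: 0; 1; 0; 0]]].

Definition SU4_mod_gens (w : F) : 6.-tuple (coset_of <[negI4]>) :=
  [tuple of map (coset <[negI4]>) (SU4_gens w)].

End Unitary.

Section Orthogonal.
(* F is GF(q), and w0 is the primitive element omega_0. *)
Variables (F : finFieldType) (w0 : F).

(* The symmetric form in the basis e1, f1, e2, f2, w1, w2.  It is of minus    *)
(* type, since w0 is not a square.                                            *)
Definition minus_form : 'M[F]_6 :=
  mxrows 6 [:: [:: 0; 1; 0; 0; 0; 0]; [:: 1; 0; 0; 0; 0; 0];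
               [:: 0; 0; 0; 1; 0; 0]; [:: 0; 0; 1; 0; 0; 0];
               [:: 0; 0; 0; 0; - 2%:R; 0]; [:: 0; 0; 0; 0; 0; 2%:R * w0]].

Definition SOminus6 : {set {'GL_6[F]}} :=
  [set g : {'GL_6[F]} |
    (GLval g *m minus_form *m (GLval g)^T == minus_form)
    && (\det (GLval g) == 1)].

Definition Omegaminus6 : {set {'GL_6[F]}} := [~: SOminus6, SOminus6].

(* The generators sigma, tau, delta, z, U'; A, B, C are the entries of delta. *)
Definition Omega_gens (A B C : F) : 5.-tuple {'GL_6[F]} :=
  [tuple
    GLrows 6 [:: [:: 1; 0; 1; 0; 0; 0]; [:: 0; 1; 0; 0; 0; 0];
                 [:: 0; 0; 1; 0; 0; 0]; [:: 0; -1; 0; 1; 0; 0];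
                 [:: 0; 0; 0; 0; 1; 0]; [:: 0; 0; 0; 0; 0; 1]];
    GLrows 6 [:: [:: 1; 1; 0; 0; 1; 0]; [:: 0; 1; 0; 0; 0; 0];
                 [:: 0; 0; 1; 0; 0; 0]; [:: 0; 0; 0; 1; 0; 0];
                 [:: 0; 2%:R; 0; 0; 1; 0]; [:: 0; 0; 0; 0; 0; 1]];
    GLrows 6 [:: [:: w0^-1; 0; 0; 0; 0; 0]; [:: 0; w0; 0; 0; 0; 0];
                 [:: 0; 0; 1; 0; 0; 0]; [:: 0; 0; 0; 1; 0; 0];
                 [:: 0; 0; 0; 0; A; - C]; [:: 0; 0; 0; 0; - B; A]];
    GLrows 6 [:: [:: 0; 1; 0; 0; 0; 0]; [:: 1; 0; 0; 0; 0; 0];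
                 [:: 0; 0; 1; 0; 0; 0]; [:: 0; 0; 0; 1; 0; 0];
                 [:: 0; 0; 0; 0; -1; 0]; [:: 0; 0; 0; 0; 0; 1]];
    GLrows 6 [:: [:: 0; 0; 1; 0; 0; 0]; [:: 0; 0; 0; 1; 0; 0];
                 [:: -1; 0; 0; 0; 0; 0]; [:: 0; -1; 0; 0; 0; 0];
                 [:: 0; 0; 0; 0; 1; 0]; [:: 0; 0; 0; 0; 0; 1]]].

End Orthogonal.

(* Main.v *)
Require Import Defs.
From mathcomp Require Import all_boot all_order all_fingroup all_algebra.
From mathcomp Require Import all_solvable all_field.
From mathcomp Require Import ring.
Import GRing.Theory.
Local Open Scope ring_scope.

Set Implicit Arguments.
Unset Strict Implicit.
Unset Printing Implicit Defensive.

(** Let q be the order of F.  SU(4,q) acts on the exterior square of its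
    natural module, a space of dimension 6 over K on which -1 is trivial.  In
    the basis e1^f2, f1^e2, -psi f1^f2, psi^-1 e1^e2, e1^f1 - e2^f2,
    psi (e1^f1 + e2^f2) the letters s, t, z, d, D, u act by the matrices of
    tau^-1, sigma, U', delta delta^-U', delta, z U'^2, all with entries in F.
    So SU(4,q)/<-1> is isomorphic to the group G generated by sigma, tau,
    delta, z, U', the isomorphism being the given substitution; two things
    remain, the transport of the presentation and the equality of G with the
    commutator subgroup of the special orthogonal group.

    The exterior square is modelled by alternating 4 x 4 matrices X, on which
    g acts by X |-> g^T X g, and the isomorphism is kept as a relation:
    [covers N M] says that N acts on the F-span of the basis above as M does.
    This relation is compatible with products and inverses, N determines M
    ([covers_inj]), and M = 1 forces N = 1 or N = -1 ([covers_ker]).  It is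
    checked on each letter by computation, and propagates to all words
    ([lifts_words]).

    Presentation ([Omega_relP]).  As the substitution sends s^-1 to tau, t to
    sigma, D to delta, z to U' and u z^-2 to z, it has a right inverse on words.
    A word v in sigma, tau, delta, z, U' is therefore the image of a word v' in
    the letters of SU(4,q); v is trivial in G if and only if v' is trivial
    modulo -1, that is, if v' is a consequence of the given relators, and then
    the substitution shows that v is a consequence of their images.

    The group ([G_eq_derived_SO]).  Each root element of SU(4,q) that is needed
    is a commutator of a root element with D, and each of s, t, z, D, u is a
    product of conjugates of root elements; hence G, which is generated by
    their images, is perfect ([G_perfect]).  So G has determinant 1, and it lies
    in the commutator subgroup of the special orthogonal group SO.  Conversely,
    the images in G of the root elements and of the tori of SU(4,q) are
    transitive enough to carry any element of SO, by multiplication on the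
    right, to some diag(c, c^-1, 1, 1, 1, 1)
    ([reduce_isometry]).  This matrix is in G when c is a square, so that G has
    index at most 2 in SO, and contains [SO, SO] ([derived_SO_sub]). *)

(** * Evaluation of words in a free group *)

Section FreeGroupEval.
Local Open Scope group_scope.
Variables (G : groupType) (n : nat).
Implicit Types (xs : n.-tuple G) (v w : freegroup 'I_n).

Definition letter_value xs (a : 'I_n * bool) : G :=
  if a.2 then (tnth xs a.1)^-1 else tnth xs a.1.

Lemma letter_valueV xs a : letter_value xs (linv a) = (letter_value xs a)^-1.
Proof. by case: a => i [] //=; rewrite /letter_value /= invgK. Qed.

(** Each cancellation made by [reduce] removes a letter next to its inverse,
    which does not change the product; this makes evaluation a homomorphism. *)
Lemma prod_reduce xs s :
  \prod_(a <- reduce s) letter_value xs a = \prod_(a <- s) letter_value xs a.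
Proof.
elim: s => //= a s IHs; rewrite big_cons -{}IHs.
case: (reduce s) => [|b s'] /=; first by rewrite big_cons.
case: eqP => [->|_]; last by rewrite !big_cons.
by rewrite big_cons letter_valueV mulKVg.
Qed.

Lemma fgevalM xs v w : fgeval xs (v * w) = fgeval xs v * fgeval xs w.
Proof. by rewrite /fgeval [LHS](prod_reduce xs) big_cat. Qed.

Lemma fgeval1 xs : fgeval xs 1 = 1.
Proof. by rewrite /fgeval big_nil. Qed.

Lemma fgevalV xs w : fgeval xs w^-1 = (fgeval xs w)^-1.
Proof. by apply: (mulgI (fgeval xs w)); rewrite -fgevalM !mulgV fgeval1. Qed.

Lemma fgevalX xs w k : fgeval xs (w ^+ k) = fgeval xs w ^+ k.
Proof. by elim: k => [|k IHk]; rewrite ?fgeval1 // !expgS fgevalM IHk. Qed.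

Lemma fgevalJ xs v w : fgeval xs (v ^ w) = fgeval xs v ^ fgeval xs w.
Proof. by rewrite !conjgE !fgevalM fgevalV. Qed.

Lemma fgeval_letter xs i : fgeval xs (tnth (letters n) i) = tnth xs i.
Proof. by rewrite tnth_mktuple /fgeval /= big_seq1. Qed.

End FreeGroupEval.

Section FreeGroupMaps.
Local Open Scope group_scope.

Lemma fgeval_comp (G : groupType) m n (xs : n.-tuple G)
    (ys : m.-tuple (freegroup 'I_n)) (w : freegroup 'I_m) :
  fgeval xs (fgeval ys w) = fgeval [tuple fgeval xs (tnth ys i) | i < m] w.
Proof.
rewrite {2 3}/fgeval; elim: (fgword w) => [|a s IHs].
  by rewrite !big_nil fgeval1.
rewrite !big_cons fgevalM IHs tnth_mktuple.
by case: a.2 => //; rewrite fgevalV.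
Qed.

Lemma fgeval_letters n (w : freegroup 'I_n) : fgeval (letters n) w = w.
Proof.
case: w => s; rewrite /fgeval /=; elim: s => [|[i b] s IHs] Hs.
  by rewrite big_nil; apply: val_inj.
rewrite big_cons (IHs (reduced_tail Hs)) tnth_mktuple; apply: val_inj.
by case: b Hs => Hs; rewrite -[RHS](reduce_id Hs) /= (reduce_id (reduced_tail Hs)).
Qed.

Lemma fgeval_morph (aT rT : finGroupType) (D : {group aT})
    (f : {morphism D >-> rT}) n (xs : n.-tuple aT) (w : freegroup 'I_n) :
  (forall i, tnth xs i \in D) ->
  fgeval xs w \in D /\ f (fgeval xs w) = fgeval [tuple of map f xs] w.
Proof.
move=> Dxs; rewrite /fgeval; elim: (fgword w) => [|a s [Ds IHs]].
  by rewrite !big_nil group1 morph1.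
have Da : (if a.2 then (tnth xs a.1)^-1 else tnth xs a.1) \in D.
  by case: a.2; rewrite ?groupV.
rewrite !big_cons groupM // morphM // IHs tnth_map; split=> //.
by case: a.2 => //; rewrite morphV.
Qed.

Lemma gen_fgeval (gT : finGroupType) n (xs : n.-tuple gT) x :
  x \in <<[set:: xs]>> -> exists w, x = fgeval xs w.
Proof.
case/gen_prodgP => m [c c_xs ->]; elim: m c c_xs => [|m IHm] c c_xs.
  by exists 1; rewrite big_ord0 fgeval1.
have [w def_w] := IHm (fun i => c (lift ord0 i)) (fun i => c_xs _).
have := c_xs ord0; rewrite inE => /tnthP[i def_i].
exists (tnth (letters n) i * w).
by rewrite big_ord_recl def_w fgevalM fgeval_letter -def_i.
Qed.

Lemma fgeval_gen (gT : finGroupType) n (xs : n.-tuple gT) w :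
  fgeval xs w \in <<[set:: xs]>>.
Proof.
apply: group_prod => a _; have : tnth xs a.1 \in <<[set:: xs]>>.
  by rewrite mem_gen // inE mem_tnth.
by case: a.2; rewrite ?groupV.
Qed.

Lemma normal_closure_image (G H : groupType) (f : G -> H) (R : G -> Prop) x :
  f 1 = 1 -> {morph f : x y / x * y} -> {morph f : x / x^-1} ->
  normal_closure R x -> normal_closure (image_rel f R) (f x).
Proof.
move=> f1 fM fV; elim=> {x} [x Rx||x y _ Ix _ Iy|x _ Ix|x y _ Ix].
- by apply: NclRel; exists x.
- by rewrite f1; apply: NclOne.
- by rewrite fM; apply: NclMul.
- by rewrite fV; apply: NclInv.
- by rewrite conjgE !fM fV -conjgE; apply: NclConj.
Qed.

End FreeGroupMaps.

(** * Faithful matrix representations of finite groups *)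

Lemma GLrowsE (R : finComUnitRingType) n (rows : seq (seq R)) :
  mxrows n.-1.+1 rows \in unitmx ->
  GLval (GLrows n rows) = mxrows n.-1.+1 rows.
Proof. by move=> U; rewrite /GLrows [LHS]insubdK. Qed.

Section FaithfulRepresentation.
Variables (R : comUnitRingType) (gT : finGroupType) (n : nat).
Variable f : gT -> 'M[R]_n.

(** The groups of the theorem enter the arguments below only through an
    injective multiplicative map to invertible matrices. *)
Definition faithful_rep :=
  [/\ injective f, {morph f : x y / (x * y)%g >-> x *m y}
    & forall x, f x \in unitmx].

Hypothesis f_rep : faithful_rep.

Lemma rep_inj : injective f. Proof. by case: f_rep. Qed.

Lemma repM x y : f (x * y)%g = f x *m f y. Proof. by case: f_rep. Qed.

Lemma rep1 : f 1%g = 1%:M.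
Proof.
have [_ _ /(_ 1%g) u1] := f_rep.
by apply: (can_inj (mulKmx u1)); rewrite mulmx1 -repM mulg1.
Qed.

Lemma repV_eq x M : f x *m M = 1%:M -> f x^-1%g = M.
Proof.
have [_ _ /(_ x) ux] := f_rep; move=> xM.
by apply: (can_inj (mulKmx ux)); rewrite xM -repM mulgV rep1.
Qed.

Lemma repV x : f x^-1%g = invmx (f x).
Proof. by have [_ _ /(_ x) ux] := f_rep; apply: repV_eq; rewrite mulmxV. Qed.

End FaithfulRepresentation.

Lemma GLval_faithful (R : finComUnitRingType) n :
  faithful_rep (fun g : {'GL_n[R]} => GLval g).
Proof. by split=> [x y|x y|x]; [apply: val_inj | | apply: GL_unitmx]. Qed.

(** A commutator has determinant 1, as determinants commute. *)
Lemma det_perfect (gT : finGroupType) (R : comUnitRingType) n (f : gT -> 'M[R]_n)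
    (H : {group gT}) : faithful_rep f -> H \subset H^`(1)%g ->
  forall x, x \in H -> \det (f x) = 1.
Proof.
move=> f_rep perfH; have [_ _ f_unit] := f_rep.
pose D := [set x | \det (f x) == 1].
have gD : group_set D.
  apply/group_setP; split=> [|x y]; rewrite !inE ?(rep1 f_rep) ?det1 //.
  by move=> /eqP dx /eqP dy; rewrite (repM f_rep) det_mulmx dx dy mulr1.
move=> x /(subsetP perfH); rewrite derg1 => HRx.
have /subsetP/(_ x HRx) : [~: H, H]%g \subset group gD; last by rewrite inE => /eqP.
rewrite gen_subG; apply/subsetP => _ /imset2P[y z _ _ ->]; rewrite inE.
have uzy : \det (f (z * y)%g) \is a GRing.unit by rewrite -unitmxE.
apply/eqP; apply: (mulrI uzy); rewrite -det_mulmx -(repM f_rep) mulr1.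
have -> : (z * y * [~ y, z] = y * z)%g by rewrite commgEl conjgE -!mulgA !mulKVg.
by rewrite !(repM f_rep) !det_mulmx mulrC.
Qed.

(** * Matrices given by lists of rows *)

Section Rows.
Variable R : nzRingType.
Implicit Types (a b : seq (seq R)).

Definition entry a i j := (nth [::] a i)`_j.
Definition mkrows n (f : nat -> nat -> R) := mkseq (fun i => mkseq (f i) n) n.
(** The product of two matrices is again a list of rows, so that identities
    between explicit matrices reduce by evaluation to identities between their
    entries. *)
Definition mulrows n a b := mkrows n (fun i j =>
  foldr (fun k c => entry a i k * entry b k j + c) 0 (iota 0 n)).
Definition trrows n a := mkrows n (fun i j => entry a j i).
Definition idrows n := mkrows n (fun i j => if eqn i j then 1 else 0).

Lemma mxrowsE n a i j : mxrows n a i j = entry a i j.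
Proof. by rewrite mxE. Qed.

Lemma mkrowsE n f : mxrows n (mkrows n f) = \matrix_(i, j) f i j.
Proof. by apply/matrixP => i j; rewrite !mxE !nth_mkseq. Qed.

Lemma mxrowsM n a b : mxrows n a *m mxrows n b = mxrows n (mulrows n a b).
Proof.
apply/matrixP => i j; rewrite mkrowsE !mxE.
under eq_bigr => k _ do rewrite !mxrowsE.
rewrite -(big_mkord xpredT (fun k => entry a i k * entry b k j)) /index_iota subn0.
by elim: (iota 0 n) => [|k s IHs]; rewrite ?big_nil //= big_cons IHs.
Qed.

Lemma mxrows_tr n a : (mxrows n a)^T = mxrows n (trrows n a).
Proof. by apply/matrixP => i j; rewrite mkrowsE !mxE. Qed.

Lemma mxrows1 n : 1%:M = mxrows n (idrows n).
Proof. by apply/matrixP => i j; rewrite mkrowsE !mxE eqnE val_eqE; case: eqP. Qed.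

Definition vec n (l : seq R) : 'rV[R]_n := \row_j l`_j.
Definition coords n (v : 'rV[R]_n.+1) := mkseq (fun k => v 0 (inord k)) n.+1.
Definition mulvec n (l : seq R) a := mkseq (fun j =>
  foldr (fun k c => l`_k * entry a k j + c) 0 (iota 0 n)) n.

Lemma coordsK n (v : 'rV[R]_n.+1) : vec n.+1 (coords v) = v.
Proof. by apply/rowP => j; rewrite mxE nth_mkseq // inord_val. Qed.

Lemma coords_vec n (l : seq R) : size l = n.+1 -> coords (vec n.+1 l) = l.
Proof.
move=> size_l; apply: (@eq_from_nth _ 0); rewrite size_mkseq // => i lt_i_n.
by rewrite nth_mkseq // mxE inordK.
Qed.

Lemma vecM n l a : vec n l *m mxrows n a = vec n (mulvec n l a).
Proof.
apply/rowP => j; rewrite !mxE nth_mkseq //.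
under eq_bigr => k _ do rewrite mxE mxrowsE.
rewrite -(big_mkord xpredT (fun k => l`_k * entry a k j)) /index_iota subn0.
by elim: (iota 0 n) => [|k s IHs]; rewrite ?big_nil //= big_cons IHs.
Qed.

End Rows.

Lemma map_mxrows (R S : nzRingType) (f : R -> S) n (a : seq (seq R)) :
  f 0 = 0 -> map_mx f (mxrows n a) = mxrows n (map (map f) a).
Proof.
move=> f0; apply/matrixP => i j; rewrite !mxE.
have [lt_i | le_i] := ltnP i (size a); last first.
  by rewrite !(nth_default [::]) ?size_map // !nth_nil f0.
rewrite (nth_map [::]) //.
have [lt_j | le_j] := ltnP j (size (nth [::] a i)); first by rewrite (nth_map 0).
by rewrite !(nth_default 0) ?size_map // f0.
Qed.

(** Call by value matters here: the inner products must be evaluated once,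
    and not at every access to one of their entries. *)
Ltac rows_eval :=
  cbv [mulrows trrows idrows mkrows mulvec mkseq entry foldr map seq.iota
       nth eqn Nat.pred].

Lemma eq_cons T (x y : T) s t : x = y -> s = t -> x :: s = y :: t.
Proof. by move=> -> ->. Qed.

Ltac split_lists :=
  repeat lazymatch goal with
  | |- _ :: _ = _ :: _ => apply: eq_cons
  | |- [::] = [::] => reflexivity
  end.

Ltac rows_split := apply: congr1; split_lists.
Section Matrices.
Variable R : comUnitRingType.

(** In the basis e1, f1, e2, f2; unitary when m is the conjugate of l. *)
Definition elem_s (l m : R) := [:: [:: 1; 0; l; 0]; [:: 0; 1; 0; 0];
                                   [:: 0; 0; 1; 0]; [:: 0; - m; 0; 1]].
(** A transvection, unitary when c has trace 0. *)
Definition elem_t (c : R) := [:: [:: 1; c; 0; 0]; [:: 0; 1; 0; 0];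
                                 [:: 0; 0; 1; 0]; [:: 0; 0; 0; 1]].
Definition torus4 (a b c d : R) := [:: [:: a; 0; 0; 0]; [:: 0; b; 0; 0];
                                       [:: 0; 0; c; 0]; [:: 0; 0; 0; d]].
Definition weyl_z (c : R) := [:: [:: 0; - c; 0; 0]; [:: c^-1; 0; 0; 0];
                                 [:: 0; 0; 1; 0]; [:: 0; 0; 0; 1]].
Definition weyl_u : seq (seq R) :=
  [:: [:: 0; 0; 1; 0]; [:: 0; 0; 0; 1]; [:: 1; 0; 0; 0]; [:: 0; 1; 0; 0]].

Definition sigma_rows (c : R) :=
  [:: [:: 1; 0; c; 0; 0; 0]; [:: 0; 1; 0; 0; 0; 0];
      [:: 0; 0; 1; 0; 0; 0]; [:: 0; - c; 0; 1; 0; 0];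
      [:: 0; 0; 0; 0; 1; 0]; [:: 0; 0; 0; 0; 0; 1]].
(** The Siegel transformation that sends e1 to e1 + a w1 + b w2 + N f1; the
    coefficient N is forced by the singularity of the image. *)
Definition tau_rows (w0 a b : R) :=
  [:: [:: 1; a ^+ 2 - w0 * b ^+ 2; 0; 0; a; b]; [:: 0; 1; 0; 0; 0; 0];
      [:: 0; 0; 1; 0; 0; 0]; [:: 0; 0; 0; 1; 0; 0];
      [:: 0; 2%:R * a; 0; 0; 1; 0]; [:: 0; - (2%:R * w0 * b); 0; 0; 0; 1]].
Definition torus6 (a b c d x y z t : R) :=
  [:: [:: a; 0; 0; 0; 0; 0]; [:: 0; b; 0; 0; 0; 0];
      [:: 0; 0; c; 0; 0; 0]; [:: 0; 0; 0; d; 0; 0];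
      [:: 0; 0; 0; 0; x; y]; [:: 0; 0; 0; 0; z; t]].
Definition z_rows : seq (seq R) :=
  [:: [:: 0; 1; 0; 0; 0; 0]; [:: 1; 0; 0; 0; 0; 0];
      [:: 0; 0; 1; 0; 0; 0]; [:: 0; 0; 0; 1; 0; 0];
      [:: 0; 0; 0; 0; -1; 0]; [:: 0; 0; 0; 0; 0; 1]].
Definition U_rows : seq (seq R) :=
  [:: [:: 0; 0; 1; 0; 0; 0]; [:: 0; 0; 0; 1; 0; 0];
      [:: -1; 0; 0; 0; 0; 0]; [:: 0; -1; 0; 0; 0; 0];
      [:: 0; 0; 0; 0; 1; 0]; [:: 0; 0; 0; 0; 0; 1]].
(** The product of z and the square of U'. *)
Definition u_rows : seq (seq R) :=
  [:: [:: 0; -1; 0; 0; 0; 0]; [:: -1; 0; 0; 0; 0; 0];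
      [:: 0; 0; -1; 0; 0; 0]; [:: 0; 0; 0; -1; 0; 0];
      [:: 0; 0; 0; 0; -1; 0]; [:: 0; 0; 0; 0; 0; 1]].

End Matrices.

Ltac matrices_eval :=
  cbv [elem_s elem_t torus4 weyl_z weyl_u sigma_rows tau_rows torus6
       z_rows U_rows u_rows]; rows_eval.

Ltac simpl_ring :=
  rewrite ?(mul0r, mulr0, add0r, addr0, mul1r, mulr1, oppr0, mulNr, mulrN, opprK).

Ltac rows_check :=
  rewrite ?mxrows1 ?mxrows_tr; matrices_eval; simpl_ring;
  repeat (rewrite mxrowsM; rows_eval; simpl_ring); rows_split.

(** * The action on alternating matrices *)

Section AlternatingAction.
Variables (F K : fieldType) (iota : {rmorphism F -> K}) (psi : K) (w0 : F).
Hypotheses (psi_neq0 : psi != 0) (psi2 : psi ^+ 2 = iota w0)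
  (two_neq0 : 2%:R != 0 :> K).
Implicit Types (N : 'M[K]_4) (M : 'M[F]_6).

(** The coordinates of l are taken in the basis e1^f2, f1^e2, -psi f1^f2,
    psi^-1 e1^e2, e1^f1 - e2^f2, psi (e1^f1 + e2^f2), where x^y stands for
    the alternating matrix x^T y - y^T x.  The factors psi make the unitary
    group act over F, with the given quadratic form of minus type. *)
Definition altrows (l : seq K) : seq (seq K) :=
  let: c := l`_4 + psi * l`_5 in let: d := psi * l`_5 - l`_4 in
  [:: [:: 0; c; l`_3 / psi; l`_0];
      [:: - c; 0; l`_1; - psi * l`_2];
      [:: - (l`_3 / psi); - l`_1; 0; d];
      [:: - l`_0; psi * l`_2; - d; 0]].

Definition alt (v : 'rV[F]_6) : 'M[K]_4 :=
  mxrows 4 (altrows (map iota (coords v))).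

Lemma alt_vec l : size l = 6 -> alt (vec 6 l) = mxrows 4 (altrows (map iota l)).
Proof. by move=> size_l; rewrite /alt coords_vec. Qed.

(** A relation and not a map, as M exists only if N respects the F-span of the
    basis; no formula for M in terms of N is then needed for products and words. *)
Definition covers N M := forall v, N^T *m alt v *m N = alt (v *m M).

Lemma coversM N M N' M' :
  covers N M -> covers N' M' -> covers (N *m N') (M *m M').
Proof. by move=> H H' v; rewrite trmx_mul (mulmxA v) -H' -H !mulmxA. Qed.

Lemma covers1 : covers 1%:M 1%:M.
Proof. by move=> v; rewrite trmx1 mul1mx !mulmx1. Qed.

Lemma coversV N M : N \in unitmx -> M \in unitmx ->
  covers N M -> covers (invmx N) (invmx M).
Proof.
move=> uN uM H v; rewrite -{1}(mulmxKV uM v) -H trmx_inv !mulmxA.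
by rewrite mulVmx ?unitmx_tr // mul1mx -!mulmxA mulmxV ?mulmx1.
Qed.

Lemma alt_inj : injective alt.
Proof.
move=> v v' eq_vv'; rewrite -(coordsK v) -(coordsK v').
have {}eq_vv' i j : alt v i j = alt v' i j by rewrite eq_vv'.
move: (eq_vv' (inord 0) (inord 1)) (eq_vv' (inord 0) (inord 2))
  (eq_vv' (inord 0) (inord 3)) (eq_vv' (inord 1) (inord 2))
  (eq_vv' (inord 1) (inord 3)) (eq_vv' (inord 2) (inord 3)).
rewrite /alt !mxrowsE /entry !inordK //=.
move=> h01 h02 h03 h12 h13 h23; congr vec.
have psiI : injective ( *%R psi) by apply: mulfI.
have e5: iota (v 0 (inord 5)) = iota (v' 0 (inord 5)).
  apply: psiI; apply: (mulfI two_neq0).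
  have sum2 (x y : K) : 2%:R * x = (y + x) + (x - y) by ring.
  by rewrite (sum2 _ (iota (v 0 (inord 4)))) h01 h23 -sum2.
rewrite /coords /mkseq /=; repeat (apply: eq_cons); try reflexivity;
  apply: (fmorph_inj iota) => //.
- by apply: psiI; apply: oppr_inj; rewrite -!mulNr.
- by apply: (mulIf (invr_neq0 psi_neq0)).
- by move: h01; rewrite e5 => /addIr.
Qed.

Lemma covers_inj N M M' : covers N M -> covers N M' -> M = M'.
Proof.
move=> H H'; apply/row_matrixP => i; rewrite !rowE.
by apply: alt_inj; rewrite -H -H'.
Qed.

Lemma coversN N M : covers N M -> covers (- N) M.
Proof.
move=> H v; have -> : (- N)^T = - N^T by apply/matrixP => i j; rewrite !mxE.
by rewrite mulNmx mulmxN mulNmx opprK. Qed.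

(** Over K the six matrices span all alternating matrices; e1^f1 itself is
    not in their F-span. *)
Lemma alternating_alt (X : 'M[K]_4) :
  (forall i, X i i = 0) -> (forall i j, X i j = - X j i) ->
  exists c : 'I_6 -> K, X = \sum_k c k *: alt (delta_mx 0 k).
Proof.
move=> X0 Xalt; pose x i j := X (inord i) (inord j).
exists (fun k => [:: x 0 3; x 1 2; - x 1 3 / psi; psi * x 0 2;
                    (x 0 1 - x 2 3) / 2%:R; (x 0 1 + x 2 3) / (2%:R * psi)]`_k).
have altE (k : 'I_6) : alt (delta_mx 0 k) =
  mxrows 4 (altrows (mkseq (fun i => (i == k)%:R) 6)).
  rewrite /alt -map_comp; congr (mxrows _ (altrows _)); apply/eq_in_map => i.
  rewrite mem_iota => /= lt_i.
  by rewrite mxE eqxx /= -val_eqE /= inordK // rmorph_nat.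
apply/matrixP => i j; rewrite summxE.
under eq_bigr => k _ do rewrite mxE altE mxrowsE.
rewrite !big_ord_recl big_ord0.
have -> : X i j = x i j by rewrite /x !inord_val.
have x0 k : x k k = 0 by apply: X0.
have xalt k l : x k l = - x l k by apply: Xalt.
case: i => [[|[|[|[|//]]]] lt_i]; case: j => [[|[|[|[|//]]]] lt_j];
  rewrite /= /entry /= ?x0;
  rewrite ?(xalt 1 0) ?(xalt 2 0) ?(xalt 2 1) ?(xalt 3 0) ?(xalt 3 1) ?(xalt 3 2);
  field; rewrite ?psi_neq0 ?two_neq0 //.
Qed.

Lemma mul_delta_quad (N : 'M[K]_4) i j a b :
  (N^T *m delta_mx i j *m N) a b = N i a * N j b.
Proof.
rewrite -(mul_delta_mx (0 : 'I_1)) !mulmxA -colE -mulmxA -rowE.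
by rewrite !mxE big_ord1 !mxE.
Qed.

Lemma exists_other (i j : 'I_4) : exists k, (k != i) && (k != j).
Proof.
have /card_gt0P[k] : (0 < #|~: [set i; j]|)%N.
  by rewrite cardsCs setCK card_ord cards2; case: (i != j).
by rewrite !inE negb_or; exists k.
Qed.

(** A matrix that fixes every e_i^e_j preserves every coordinate plane, hence
    every coordinate line; its eigenvalues c_i satisfy c_i c_j = 1 for i <> j,
    so that they are all equal to 1 or all equal to -1. *)
Lemma covers_ker N : covers N 1%:M -> N = 1%:M \/ N = - 1%:M.
Proof.
move=> H; pose m i j a b := N i a * N j b - N j a * N i b.
(* N fixes X = e_i^e_j, so row i ^ row j = e_i^e_j, coordinate by coordinate. *)
have minorE i j a b : i != j ->
    m i j a b = ((a == i) && (b == j))%:R - ((a == j) && (b == i))%:R.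
  move=> neq_ij; pose X : 'M[K]_4 := delta_mx i j - delta_mx j i.
  have [c defX] : exists c : 'I_6 -> K, X = \sum_k c k *: alt (delta_mx 0 k).
    apply: alternating_alt => [k|k l]; rewrite !mxE.
      by rewrite andbC subrr.
    by rewrite opprB [in RHS]andbC [(l == i) && _]andbC.
  have : N^T *m X *m N = X.
    rewrite defX mulmx_sumr mulmx_suml; apply: eq_bigr => k _.
    by rewrite -scalemxAr -scalemxAl H mulmx1.
  move/matrixP/(_ a b).
  have subE (Y Z : 'M[K]_4) : (Y - Z) a b = Y a b - Z a b by rewrite !mxE.
  by rewrite mulmxBr mulmxBl !subE !mul_delta_quad !mxE.
have off i a : a != i -> N i a = 0.
  move=> neq_ai; have [j /andP[neq_ji neq_ja]] := exists_other i a.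
  (* row i ^ (row i ^ row j) = 0, read at the coordinates a, i, j *)
  have : N i a * m i j i j - N i i * m i j a j + N i j * m i j a i = 0.
    by rewrite /m; ring.
  have [ai aj] : (a == i) = false /\ (a == j) = false.
    by rewrite (negPf neq_ai) eq_sym (negPf neq_ja).
  rewrite !minorE 1?eq_sym // !eqxx ai aj ?[i == j]eq_sym (negPf neq_ji) /=.
  by rewrite !subr0 !mulr0 mulr1 subr0 addr0.
have diag i j : i != j -> N i i * N j j = 1.
  move=> neq_ij; have := minorE i j i j neq_ij.
  by rewrite /m !eqxx (negPf neq_ij) /= [N i j]off 1?eq_sym // mulr0 !subr0.
pose c := N 0 0.
have Nc i : N i i = c.
  have [-> // | neq_i0] := eqVneq i 0.
  have [k /andP[neq_ki neq_k0]] := exists_other i 0.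
  have Nk : N k k != 0.
    apply/eqP => Nk0; have /eqP := diag k i neq_ki.
    by rewrite Nk0 mul0r eq_sym oner_eq0.
  by apply: (mulfI Nk); rewrite /c !diag.
have defN : N = c%:M.
  apply/matrixP => i j; rewrite !mxE; have [<- | neq_ij] := eqVneq i j.
    by rewrite mulr1n Nc.
  by rewrite mulr0n off // eq_sym.
have : c ^+ 2 = 1 by rewrite expr2 -{2}(Nc 1) diag.
move/eqP; rewrite sqrf_eq1 => /orP[]/eqP c1; [left|right]; rewrite defN c1 //.
by rewrite raddfN.
Qed.

End AlternatingAction.
Section Coverings.
Variables (F K : fieldType) (iota : {rmorphism F -> K}) (psi : K) (w0 : F).
Hypotheses (psi_neq0 : psi != 0) (psi2 : psi ^+ 2 = iota w0)
  (two_neq0 : 2%:R != 0 :> K).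
Local Notation covers := (covers iota psi).

(** Both sides are linear in v, and six indeterminate coordinates decide the
    equality at once. *)
Lemma coversP a b :
  (forall x1 y1 x2 y2 x y, let l := [:: x1; y1; x2; y2; x; y] in
     mulrows 4 (mulrows 4 (trrows 4 a) (altrows psi (map iota l))) a
     = altrows psi (map iota (mulvec 6 l b))) ->
  covers (mxrows 4 a) (mxrows 6 b).
Proof.
move=> H v; rewrite -(coordsK v) vecM !alt_vec ?size_mkseq //.
by rewrite mxrows_tr !mxrowsM H.
Qed.

Ltac covers_tac :=
  apply: coversP => x1 y1 x2 y2 e f /=;
  cbv [altrows]; matrices_eval; split_lists;
  rewrite ?(mul0r, mulr0, add0r, addr0, mul1r, mulr1);
  rewrite ?(rmorphD, rmorphM, rmorphB, rmorphN, rmorph1, rmorph0, fmorphV,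
            rmorphXn, rmorph_nat) /= -?psi2.

Lemma covers_s a b :
  covers (mxrows 4 (elem_s (psi * iota b - iota a) (- psi * iota b - iota a)))
         (mxrows 6 (tau_rows w0 a b)).
Proof. by covers_tac; field. Qed.

Lemma covers_t c :
  covers (mxrows 4 (elem_t (- psi * iota c))) (mxrows 6 (sigma_rows c)).
Proof. by covers_tac; field. Qed.

Lemma covers_z : covers (mxrows 4 (weyl_z psi)) (mxrows 6 (U_rows _)).
Proof. by covers_tac; field. Qed.

Lemma covers_d a : a != 0 ->
  covers (mxrows 4 (torus4 (iota a)^-1 (iota a) 1 1))
         (mxrows 6 (torus6 a^-1 a a a^-1 1 0 0 1)).
Proof. by move=> a0; covers_tac; field; rewrite ?psi_neq0 ?fmorph_eq0 ?a0. Qed.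

Lemma covers_u : covers (mxrows 4 (weyl_u _)) (mxrows 6 (u_rows _)).
Proof. by covers_tac; field. Qed.

(** The torus element of l = a + b psi: e1^f2 is multiplied by the inverse of
    the norm of l, and e1^f1 by the conjugate of l divided by l, an element of
    norm 1 that acts on w1, w2 as a rotation. *)
Lemma covers_D a b (l := iota a + psi * iota b) (m := iota a - psi * iota b)
   (N := a ^+ 2 - w0 * b ^+ 2) : l != 0 -> m != 0 ->
  covers (mxrows 4 (torus4 l^-1 m l m^-1))
    (mxrows 6 (torus6 N^-1 N 1 1
      ((a ^+ 2 + w0 * b ^+ 2) / N) (- (2%:R * a * b) / N)
      (- (2%:R * w0 * a * b) / N) ((a ^+ 2 + w0 * b ^+ 2) / N))).
Proof.
move=> l0 m0.
have NE : l * m = (iota a) ^+ 2 - psi ^+ 2 * (iota b) ^+ 2 by rewrite /l /m; ring.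
have N0 : (iota a) ^+ 2 - psi ^+ 2 * (iota b) ^+ 2 != 0 by rewrite -NE mulf_neq0.
by rewrite /N; covers_tac; rewrite /l /m; field;
  rewrite -/l -/m ?l0 ?m0 ?N0 ?psi_neq0 ?two_neq0.
Qed.

Lemma covers_delta (l m : K) (A B C : F) : l != 0 -> m != 0 -> iota w0 = l * m ->
  iota A = (m / l + l / m) / 2%:R ->
  iota B = psi * (l / m - m / l) / 2%:R ->
  iota C = psi^-1 * (l / m - m / l) / 2%:R ->
  covers (mxrows 4 (torus4 l^-1 m l m^-1))
    (mxrows 6 (torus6 w0^-1 w0 1 1 A (- C) (- B) A)).
Proof.
move=> l0 m0 NE hA hB hC.
by covers_tac; rewrite ?psi2 ?NE ?hA ?hB ?hC; field;
  rewrite ?l0 ?m0 ?psi_neq0 ?two_neq0.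
Qed.
End Coverings.

(** * Arithmetic of a quadratic extension of finite fields *)

Section QuadraticExtension.
Variables (F K : finFieldType) (iota : {rmorphism F -> K}).
Hypotheses (q_odd : odd #|F|) (card_K : #|K| = (#|F| ^ 2)%N).
Variables (w : K) (w0 : F).
Hypotheses (w_prim : primitive_element w) (w0_def : iota w0 = w ^+ #|F|.+1).
Local Notation q := #|F|.
Local Notation psi := (w ^+ (q.+1)./2).

Lemma card_F_gt2 : (2 < q)%N.
Proof.
have := finNzRing_gt1 F; move: q_odd.
by case: #|F| => [|[|[|n]]].
Qed.

(** q is a power of the characteristic. *)
Lemma frobeniusD (x y : K) : (x + y) ^+ q = x ^+ q + y ^+ q.
Proof.
have [p p_pr pcharFp] := finPcharP F.
apply: exprDn_pchar; rewrite (card_pprimeChar pcharFp) pnatX pnatE //.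
by rewrite (rmorph_pchar iota pcharFp).
Qed.

Lemma frobeniusN (x : K) : (- x) ^+ q = - x ^+ q.
Proof. by rewrite exprNn -signr_odd q_odd expr1 mulN1r. Qed.

Lemma frobeniusK (x : K) : (x ^+ q) ^+ q = x.
Proof. by rewrite -exprM mulnn -card_K expf_card. Qed.

Lemma frobenius_base (x : F) : iota x ^+ q = iota x.
Proof. by rewrite -rmorphXn expf_card. Qed.

Lemma two_neq0 : 2%:R != 0 :> K.
Proof.
have [p p_pr pcharFp] := finPcharP F.
apply/negP => two0; have p2: p = 2.
  have := rmorph_pchar iota pcharFp.
  have: 2 \in [pchar K] by rewrite inE /= two0.
  by move/pcharf_eq => eqp; rewrite eqp inE => /eqP.
subst p; move: (finNzRing_gt1 F) q_odd; rewrite (card_pprimeChar pcharFp).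
by case: logn => [|n] //; rewrite oddX.
Qed.

Lemma w_neq0 : w != 0.
Proof.
apply/eqP => w0'; have := prim_expr_order w_prim.
rewrite w0' expr0n card_K; have := card_F_gt2; rewrite expnS expn1.
by case: #|F| => [|[|n]] //= _ /eqP; rewrite eq_sym oner_eq0.
Qed.

Lemma card_K_pred : #|K|.-1 = (q.-1 * q.+1)%N.
Proof.
rewrite card_K; have := card_F_gt2; case: #|F| => // n _.
by rewrite -mulnn mulSn addSn [RHS]mulnS.
Qed.

Lemma psi_neq0 : psi != 0.
Proof. by rewrite expf_neq0 ?w_neq0. Qed.

Lemma psi2 : psi ^+ 2 = iota w0.
Proof. by rewrite w0_def -exprM muln2 halfK /= q_odd subn0. Qed.

(** The square of psi^(q-1) is 1, while psi^(q-1) is not, for its exponent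
    in w is half of the order of w. *)
Lemma psi_frobenius : psi ^+ q = - psi.
Proof.
have q2 := card_F_gt2.
have : (psi ^+ q.-1) ^+ 2 = 1.
  by rewrite exprAC psi2 w0_def -exprM mulnC -card_K_pred (prim_expr_order w_prim).
move/eqP; rewrite sqrf_eq1 => /orP[|/eqP eN1]; last first.
  have -> : psi ^+ q = psi ^+ q.-1 * psi by rewrite -exprSr prednK // 2?ltnW.
  by rewrite eN1 mulN1r.
rewrite -exprM -(prim_order_dvd w_prim) card_K_pred mulnC.
have q1_gt0 : (0 < q.-1)%N by rewrite -ltnS prednK 1?ltnW // ltnW.
rewrite dvdn_pmul2r //.
have half_gt0 : (0 < (q.+1)./2)%N by rewrite half_gt0 ltnS (ltnW (ltnW q2)).
move/(dvdn_leq half_gt0); rewrite leqNgt ltn_half_double.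
by rewrite -addnn -{1}[q.+1]addn0 ltn_add2l.
Qed.

Lemma frobenius_pair (a b : F) :
  (iota a + psi * iota b) ^+ q = iota a - psi * iota b.
Proof. by rewrite frobeniusD exprMn psi_frobenius !frobenius_base mulNr. Qed.

(** A square root of w0 in F would be psi or -psi, which the Frobenius map
    negates. *)
Lemma w0_nonsquare (c : F) : c ^+ 2 != w0.
Proof.
apply/eqP => c2; have : psi ^+ 2 == iota c ^+ 2 by rewrite psi2 -c2 rmorphXn.
rewrite eqf_sqr => psi_c; have fix_psi : psi ^+ q = psi.
  by case/orP: psi_c => /eqP ->; rewrite ?frobeniusN frobenius_base.
have /eqP : psi + psi = 0 by rewrite -{1}fix_psi psi_frobenius addNr.
by rewrite -mulr2n -mulr_natl mulf_eq0 (negPf two_neq0) (negPf psi_neq0).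
Qed.

(** Anisotropy of the plane of w1, w2. *)
Lemma norm_form_eq0 (a b : F) : a ^+ 2 - w0 * b ^+ 2 = 0 -> a = 0 /\ b = 0.
Proof.
have [-> | b0 /eqP] := eqVneq b 0.
  by rewrite expr0n mulr0 subr0 => /eqP; rewrite expf_eq0 => /eqP.
rewrite subr_eq0 => /eqP e; case/eqP: (w0_nonsquare (a / b)).
by rewrite expr_div_n e mulfK // expf_neq0.
Qed.

Lemma w0_neq0 : w0 != 0.
Proof. by rewrite -(fmorph_eq0 iota) w0_def expf_neq0 ?w_neq0. Qed.

(** c is a power w^i of order dividing q-1, so that q+1 divides i. *)
Lemma w0_generates (c : F) : c != 0 -> exists k, c = w0 ^+ k.
Proof.
move=> c0; have q2 := card_F_gt2.
have cq : iota c ^+ q.-1 = 1.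
  apply: (mulfI (_ : iota c != 0)); first by rewrite fmorph_eq0.
  by rewrite -exprS prednK ?(ltnW (ltnW q2)) // frobenius_base mulr1.
have ck : iota c ^+ #|K|.-1 = 1 by rewrite card_K_pred exprM cq expr1n.
have [[i lt_i] /= ci] := prim_rootP w_prim ck.
move: cq; rewrite ci -exprM => /eqP; rewrite -(prim_order_dvd w_prim).
have q1_gt0 : (0 < q.-1)%N by rewrite -ltnS prednK 1?ltnW // ltnW.
rewrite card_K_pred mulnC dvdn_pmul2r //.
case/dvdnP => k def_i; exists k; apply: (fmorph_inj iota).
by rewrite ci def_i rmorphXn w0_def -exprM mulnC.
Qed.

Lemma w0_neq1 : w0 != 1.
Proof.
by apply/eqP => w01; have := w0_nonsquare 1; rewrite expr1n w01 eqxx.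
Qed.

Lemma w2_neq1 : w ^+ 2 - 1 != 0.
Proof.
rewrite subr_eq0 -(prim_order_dvd w_prim) card_K_pred gtnNdvd //.
have := card_F_gt2; case: #|F| => [|[|[|n]]] //= _.
Qed.

End QuadraticExtension.

(** * Unitary and orthogonal matrices *)

Section UnitaryElements.
Variables (q : nat) (K : finFieldType).
Hypotheses (q_odd : odd q) (frobeniusK : forall x : K, (x ^+ q) ^+ q = x).

Definition unitary (N : 'M[K]_4) :=
  N *m hermitian_form K *m (map_mx (fun x => x ^+ q) N)^T = hermitian_form K.

Let q_neq0 : (q == 0)%N = false. Proof. by case: q q_odd. Qed.

Lemma expN (x : K) : (- x) ^+ q = - x ^+ q.
Proof. by rewrite exprNn -signr_odd q_odd expr1 mulN1r. Qed.

Ltac unitary_tac :=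
  rewrite /unitary /hermitian_form map_mxrows ?expr0n ?q_neq0 //;
  rows_check; rewrite ?(expr0n, q_neq0, expr1n, expN, exprVn) /=; simpl_ring.

Lemma unitary_s (l : K) : unitary (mxrows 4 (elem_s l (l ^+ q))).
Proof. by unitary_tac; rewrite ?frobeniusK ?subrr ?addNr. Qed.

Lemma unitary_t (c : K) : c ^+ q = - c -> unitary (mxrows 4 (elem_t c)).
Proof. by move=> cq; unitary_tac; rewrite ?cq ?subrr. Qed.

Lemma unitary_z (c : K) : c != 0 -> c ^+ q = - c -> unitary (mxrows 4 (weyl_z c)).
Proof.
move=> c0 cq; unitary_tac;
by rewrite ?cq ?invrN ?opprK ?mulNr ?mulrN ?opprK ?divff ?mulVf ?opprK.
Qed.

Lemma unitary_u : unitary (mxrows 4 (weyl_u K)).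
Proof. by unitary_tac. Qed.

Lemma unitary_torus (a b c d : K) :
  a * b ^+ q = 1 -> b * a ^+ q = 1 -> c * d ^+ q = 1 -> d * c ^+ q = 1 ->
  unitary (mxrows 4 (torus4 a b c d)).
Proof. by move=> ab ba cd dc; unitary_tac. Qed.

(** The form is nondegenerate. *)
Lemma unitary_unit N : unitary N -> N \in unitmx.
Proof.
have uJ : hermitian_form K \in unitmx.
  suff /mulmx1_unit[//] : hermitian_form K *m hermitian_form K = 1%:M.
  by rewrite /hermitian_form; rows_check.
move=> uN; have : hermitian_form K \in unitmx by [].
by rewrite -{1}uN !unitmx_mul => /andP[/andP[]].
Qed.

Lemma SU4_lift N : unitary N -> \det N = 1 ->
  exists2 g : {'GL_4[K]}, g \in SU4 q K & GLval g = N.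
Proof.
move=> uN dN; have unN := unitary_unit uN.
have gN : GLval (insubd (1%g : {'GL_4[K]}) N) = N by rewrite [LHS]insubdK.
by exists (insubd (1%g : {'GL_4[K]}) N); rewrite // inE gN uN dN !eqxx.
Qed.

Lemma det_torus4 (a b c d : K) : \det (mxrows 4 (torus4 a b c d)) = a * b * c * d.
Proof.
rewrite det_trig; first by rewrite !big_ord_recr big_ord0 /= !mxrowsE mul1r.
apply/is_trig_mxP => i j; rewrite mxrowsE.
by case: i j => [[|[|[|[|//]]]] ?] [[|[|[|[|//]]]] ?].
Qed.

Lemma det_t (c : K) : \det (mxrows 4 (elem_t c)) = 1.
Proof.
rewrite -det_tr det_trig; first by rewrite !big_ord_recr big_ord0 /= !mxE !mulr1.
apply/is_trig_mxP => i j; rewrite mxE mxrowsE.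
by case: i j => [[|[|[|[|//]]]] ?] [[|[|[|[|//]]]] ?].
Qed.

(** The matrix is a product of an upper and a lower unitriangular matrix. *)
Lemma det_s (l m : K) : \det (mxrows 4 (elem_s l m)) = 1.
Proof.
have -> : mxrows 4 (elem_s l m) = mxrows 4 (elem_s l 0) *m mxrows 4 (elem_s 0 m).
  by rows_check.
rewrite det_mulmx -det_tr !det_trig.
- by rewrite !big_ord_recr !big_ord0 /= !mxE !mulr1.
- apply/is_trig_mxP => i j; rewrite mxrowsE.
  by case: i j => [[|[|[|[|//]]]] ?] [[|[|[|[|//]]]] ?]; rewrite /entry //= oppr0.
- apply/is_trig_mxP => i j; rewrite mxE mxrowsE.
  by case: i j => [[|[|[|[|//]]]] ?] [[|[|[|[|//]]]] ?]; rewrite /entry //= oppr0.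
Qed.

End UnitaryElements.

Section OrthogonalElements.
Variables (F : finFieldType) (w0 : F).
Hypotheses (w0_neq0 : w0 != 0) (two_neq0 : 2%:R != 0 :> F).

Definition minus_isometry (M : 'M[F]_6) :=
  M *m minus_form w0 *m M^T = minus_form w0.

Ltac orthogonal_tac := rewrite /minus_isometry /minus_form; rows_check.

Lemma orthogonal_unit M : minus_isometry M -> M \in unitmx.
Proof.
have uJ : minus_form w0 \in unitmx.
  pose J' := mxrows 6 [:: [:: 0; 1; 0; 0; 0; 0]; [:: 1; 0; 0; 0; 0; 0];
    [:: 0; 0; 0; 1; 0; 0]; [:: 0; 0; 1; 0; 0; 0];
    [:: 0; 0; 0; 0; - 2%:R^-1; 0]; [:: 0; 0; 0; 0; 0; (2%:R * w0)^-1]].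
  suff /mulmx1_unit[//] : minus_form w0 *m J' = 1%:M.
  by rewrite /minus_form /J'; rows_check; rewrite ?mulfV ?mulf_neq0.
move=> oM; have : minus_form w0 \in unitmx by [].
by rewrite -{1}oM !unitmx_mul => /andP[/andP[]].
Qed.

Lemma orthogonal_sigma c : minus_isometry (mxrows 6 (sigma_rows c)).
Proof. by orthogonal_tac; rewrite ?subrr ?addNr. Qed.

Lemma orthogonal_tau a b : minus_isometry (mxrows 6 (tau_rows w0 a b)).
Proof. by orthogonal_tac; ring. Qed.

Lemma orthogonal_z : minus_isometry (mxrows 6 (z_rows F)).
Proof. by orthogonal_tac. Qed.

Lemma orthogonal_U : minus_isometry (mxrows 6 (U_rows F)).
Proof. by orthogonal_tac. Qed.

Lemma orthogonal_torus6 (a b c d x y z t : F) :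
  a * b = 1 -> c * d = 1 -> x ^+ 2 - w0 * y ^+ 2 = 1 ->
  x * z - w0 * y * t = 0 -> w0 * t ^+ 2 - z ^+ 2 = w0 ->
  minus_isometry (mxrows 6 (torus6 a b c d x y z t)).
Proof.
move=> ab cd xy xz zt; orthogonal_tac.
all: rewrite ?ab ?cd ?[b * a]mulrC ?[d * c]mulrC ?ab ?cd //.
- by rewrite -[RHS]mulr1 -xy; ring.
- by rewrite -[RHS](mulr0 (- 2%:R)) -xz; ring.
- by rewrite -[RHS](mulr0 (- 2%:R)) -xz; ring.
- by rewrite -[in RHS]zt; ring.
Qed.

End OrthogonalElements.

Section MatrixIdentities.
Variable K : fieldType.
Implicit Types (p x y : K).

(** For p = 1, this is the product u z^2; the inverse is the case p = -1. *)
Definition weyl_n p := [:: [:: 0; 0; p; 0]; [:: 0; 0; 0; p];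
                           [:: - p; 0; 0; 0]; [:: 0; - p; 0; 0]].

Ltac weyl_check := rewrite /weyl_n; rows_check.

(** In SL(2), z = t t^z t. *)
Lemma weyl_z_braid p : p != 0 ->
  mxrows 4 (weyl_z p) = mxrows 4 (elem_t (- p)) *m mxrows 4 (weyl_z (- p))
    *m mxrows 4 (elem_t (- p)) *m mxrows 4 (weyl_z p) *m mxrows 4 (elem_t (- p)).
Proof. by move=> p0; weyl_check; field; rewrite ?oppr_eq0 ?p0. Qed.

Lemma weyl_n_uz p : p != 0 ->
  mxrows 4 (weyl_n 1)
  = mxrows 4 (weyl_u K) *m mxrows 4 (weyl_z p) *m mxrows 4 (weyl_z p).
Proof. by move=> p0; weyl_check; field; rewrite ?oppr_eq0 ?p0. Qed.

Lemma weyl_nV : mxrows 4 (weyl_n 1) *m mxrows 4 (weyl_n (-1)) = 1%:M.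
Proof. by weyl_check. Qed.

(** In SL(2,K), n = s s^n s. *)
Lemma weyl_n_braid :
  mxrows 4 (weyl_n 1) = mxrows 4 (elem_s 1 1) *m mxrows 4 (weyl_n (-1))
    *m mxrows 4 (elem_s 1 1) *m mxrows 4 (weyl_n 1) *m mxrows 4 (elem_s 1 1).
Proof. by weyl_check; ring. Qed.

(** In SL(2,K), the diagonal matrix of x is n(x^-1) n(1)^-1, where n(x) is
    the product s(x) s(x^-1)^n s(x). *)
Lemma torus_weyl_n x y : x != 0 -> y != 0 ->
  mxrows 4 (torus4 x^-1 y x y^-1) *m mxrows 4 (weyl_n 1)
  = mxrows 4 (elem_s x^-1 y^-1) *m mxrows 4 (weyl_n (-1))
    *m mxrows 4 (elem_s x y) *m mxrows 4 (weyl_n 1)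
    *m mxrows 4 (elem_s x^-1 y^-1).
Proof. by move=> x0 y0; weyl_check; field; rewrite ?x0 ?y0. Qed.

End MatrixIdentities.

(** * Reduction of orthogonal matrices by root elements and tori *)

Section Elimination.
Variables (F : finFieldType) (w0 : F).
Hypotheses (w0_neq0 : w0 != 0) (two_neq0 : 2%:R != 0 :> F).
Hypothesis anisotropic : forall a b, a ^+ 2 - w0 * b ^+ 2 = 0 -> a = 0 /\ b = 0.
Hypothesis w0_generates : forall c, c != 0 -> exists k, c = w0 ^+ k.
Variables (gO : finGroupType) (mxO : gO -> 'M[F]_6).
Hypothesis mxO_rep : faithful_rep mxO.
Variable G : {group gO}.
Hypothesis G_isometry : forall x, x \in G -> minus_isometry w0 (mxO x).
Hypotheses
  (G_sigma : forall c, exists2 x, x \in G & mxO x = mxrows 6 (sigma_rows c))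
  (G_tau : forall a b, exists2 x, x \in G & mxO x = mxrows 6 (tau_rows w0 a b))
  (G_z : exists2 x, x \in G & mxO x = mxrows 6 (z_rows F))
  (G_U : exists2 x, x \in G & mxO x = mxrows 6 (U_rows F))
  (G_d : forall a, a != 0 ->
     exists2 x, x \in G & mxO x = mxrows 6 (torus6 a^-1 a a a^-1 1 0 0 1))
  (G_torus : forall a b (N := a ^+ 2 - w0 * b ^+ 2), N != 0 ->
     exists2 x, x \in G & mxO x =
       mxrows 6 (torus6 N^-1 N 1 1 ((a ^+ 2 + w0 * b ^+ 2) / N)
         (- (2%:R * a * b) / N) (- (2%:R * w0 * a * b) / N)
         ((a ^+ 2 + w0 * b ^+ 2) / N))).

Local Notation V := 'rV[F]_6.
Local Notation "v .* x" := (v *m mxO x) (at level 40).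

Definition vec6 x1 y1 x2 y2 a b : V := vec 6 [:: x1; y1; x2; y2; a; b].
Local Notation e1 := (vec6 1 0 0 0 0 0).
Local Notation f1 := (vec6 0 1 0 0 0 0).
Local Notation e2 := (vec6 0 0 1 0 0 0).
Local Notation f2 := (vec6 0 0 0 1 0 0).
Local Notation w1 := (vec6 0 0 0 0 1 0).
Local Notation w2 := (vec6 0 0 0 0 0 1).

Lemma vec6_eta (v : V) : exists x1 y1 x2 y2 a b, v = vec6 x1 y1 x2 y2 a b.
Proof. by rewrite -(coordsK v); do 6!eexists. Qed.

Lemma scale_vec6 c x1 y1 x2 y2 a b :
  c *: vec6 x1 y1 x2 y2 a b =
  vec6 (c * x1) (c * y1) (c * x2) (c * y2) (c * a) (c * b).
Proof.
apply/rowP => -[[|[|[|[|[|[|//]]]]]] ?]; by rewrite !mxE.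
Qed.

Definition dot (u v : V) : F := (u *m minus_form w0 *m v^T) 0 0.

Lemma dot_vec6 x1 y1 x2 y2 a b x1' y1' x2' y2' a' b' :
  dot (vec6 x1 y1 x2 y2 a b) (vec6 x1' y1' x2' y2' a' b') =
  x1 * y1' + y1 * x1' + x2 * y2' + y2 * x2' - 2%:R * a * a' + 2%:R * w0 * b * b'.
Proof.
rewrite /dot /minus_form vecM; rows_eval.
by rewrite mxE !big_ord_recl big_ord0 !mxE /=; ring.
Qed.

Lemma dot_isometry M u v : minus_isometry w0 M -> dot (u *m M) (v *m M) = dot u v.
Proof.
by move=> HM; rewrite /dot trmx_mul !mulmxA -(mulmxA u) -(mulmxA u) HM.
Qed.

Ltac vec_check :=
  rewrite /vec6 vecM; matrices_eval; simpl_ring; apply: congr1; split_lists.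

(** W lists vectors to be left fixed: a basis is corrected one vector at a
    time, without undoing what was achieved before. *)
Definition reach (W : seq V) (u v : V) :=
  exists2 x, x \in G & u .* x = v /\ {in W, forall f, f .* x = f}.

Lemma reach_trans W u v t : reach W u v -> reach W v t -> reach W u t.
Proof.
move=> [x Gx [uv Wx]] [y Gy [vt Wy]]; exists (x * y)%g; first exact: groupM.
rewrite (repM mxO_rep) mulmxA uv; split=> // f Wf.
by rewrite mulmxA Wx ?Wy.
Qed.

Lemma reach_sub W W' u v : {subset W' <= W} -> reach W u v -> reach W' u v.
Proof. by move=> sub [x Gx [uv Wx]]; exists x => //; split=> // f /sub/Wx. Qed.

(** Conjugation by Weyl elements transports a reduction from one pivot to
    another. *)
Lemma reachJ p W u v : p \in G -> reach W u v ->
  reach [seq f .* p | f <- W] (u .* p) (v .* p).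
Proof.
have pK t : t .* p .* p^-1%g = t.
  by rewrite -mulmxA -(repM mxO_rep) mulgV (rep1 mxO_rep) mulmx1.
move=> Gp [x Gx [uv Wx]]; exists (p^-1 * x * p)%g.
  by rewrite !groupM ?groupV.
rewrite !(repM mxO_rep) !mulmxA pK uv; split=> // _ /mapP[f Wf ->].
by rewrite !mulmxA pK Wx.
Qed.

Lemma reach_dot W u v : reach W u v -> dot v v = dot u u.
Proof. by case=> x Gx [<- _]; apply/dot_isometry/G_isometry. Qed.

(** The conjugate of z by U', which exchanges e2 and f2. *)
Lemma G_z2 : exists2 x, x \in G & mxO x = mxrows 6
  [:: [:: 1; 0; 0; 0; 0; 0]; [:: 0; 1; 0; 0; 0; 0];
      [:: 0; 0; 0; 1; 0; 0]; [:: 0; 0; 1; 0; 0; 0];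
      [:: 0; 0; 0; 0; -1; 0]; [:: 0; 0; 0; 0; 0; 1]].
Proof.
have [[z Gz zE] [U GU UE]] := (G_z, G_U).
exists (U^-1 * z * U)%g; first by rewrite !groupM ?groupV.
have [_ _ /(_ U) unitU] := mxO_rep.
apply: (can_inj (mulKmx unitU)); rewrite -(repM mxO_rep) !mulgA mulgV mul1g.
by rewrite (repM mxO_rep) zE UE; rows_check.
Qed.

Lemma clear_w x1 y1 x2 y2 a b : x1 != 0 ->
  exists y, reach [:: f1; e2; f2] (vec6 x1 y1 x2 y2 a b) (vec6 x1 y x2 y2 0 0).
Proof.
move=> nx1; have [x Gx xE] := G_tau (- a / x1) (- b / x1).
eexists; exists x => //; rewrite xE; split.
  by vec_check; last 2 first; [field | field | reflexivity..].
by move=> f; rewrite !inE => /or3P[]/eqP->; vec_check.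
Qed.

Lemma clear_e2 x1 y1 x2 y2 : x1 != 0 ->
  exists y, reach [:: f1] (vec6 x1 y1 x2 y2 0 0) (vec6 x1 y 0 y2 0 0).
Proof.
move=> nx1; have [x Gx xE] := G_sigma (- x2 / x1).
eexists; exists x => //; rewrite xE; split.
  by vec_check; [reflexivity | reflexivity | field | reflexivity..].
by move=> f; rewrite !inE => /eqP->; vec_check.
Qed.

(** In a reduced singular vector the coordinate opposite to the pivot
    vanishes by itself. *)
Lemma dot_self_pivot x1 y :
  x1 != 0 -> dot (vec6 x1 y 0 0 0 0) (vec6 x1 y 0 0 0 0) = 0 -> y = 0.
Proof.
move=> nx1; rewrite dot_vec6 !mulr0 !addr0 subr0 [y * x1]mulrC -mulr2n -mulr_natl.
by move/eqP; rewrite !mulf_eq0 (negPf two_neq0) (negPf nx1) => /eqP.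
Qed.

(** The Siegel transformation clears the coordinates on w1 and w2, and two
    root elements those on e2 and f2. *)
Lemma pivot_e1 x1 y1 x2 y2 a b (v := vec6 x1 y1 x2 y2 a b) :
  x1 != 0 -> dot v v = 0 -> reach [:: f1] v (vec6 x1 0 0 0 0 0).
Proof.
move=> nx1 v0; have [y R1] := clear_w y1 x2 y2 a b nx1.
have {}R1 : reach [:: f1] v (vec6 x1 y x2 y2 0 0).
  by apply: reach_sub R1 => f; rewrite !inE => ->.
have [y' R2] := clear_e2 y x2 y2 nx1; have [y'' R3] := clear_e2 y' y2 0 nx1.
have [p Gp pE] := G_z2; have {}R3 := reachJ Gp R3.
have pv s t r k : vec6 s t r k 0 0 .* p = vec6 s t k r 0 0.
  by rewrite pE; vec_check; rewrite ?oppr0.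
rewrite /= !pv in R3; have R := reach_trans R1 (reach_trans R2 R3).
suff y''0 : y'' = 0 by rewrite y''0 in R.
by apply: (dot_self_pivot nx1); rewrite (reach_dot R).
Qed.

Lemma pivot_e1_plane x1 y1 a b (v := vec6 x1 y1 0 0 a b) :
  x1 != 0 -> dot v v = 0 -> reach [:: f1; e2; f2] v (vec6 x1 0 0 0 0 0).
Proof.
move=> nx1 v0; have [y R] := clear_w y1 0 0 a b nx1.
suff y0 : y = 0 by rewrite y0 in R.
by apply: (dot_self_pivot nx1); rewrite (reach_dot R).
Qed.

Lemma vec6_z z x1 y1 x2 y2 a b : mxO z = mxrows 6 (z_rows F) ->
  vec6 x1 y1 x2 y2 a b .* z = vec6 y1 x1 x2 y2 (- a) b.
Proof. by move=> zE; rewrite zE; vec_check. Qed.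

Lemma vec6_U U x1 y1 x2 y2 a b : mxO U = mxrows 6 (U_rows F) ->
  vec6 x1 y1 x2 y2 a b .* U = vec6 (- x2) (- y2) x1 y1 a b.
Proof. by move=> UE; rewrite UE; vec_check. Qed.

Lemma dot_w a b :
  dot (vec6 0 0 0 0 a b) (vec6 0 0 0 0 a b) = - 2%:R * (a ^+ 2 - w0 * b ^+ 2).
Proof. by rewrite dot_vec6; ring. Qed.

Lemma singular_w a b :
  dot (vec6 0 0 0 0 a b) (vec6 0 0 0 0 a b) = 0 -> vec6 0 0 0 0 a b = 0.
Proof.
rewrite dot_w => /eqP; rewrite mulf_eq0 oppr_eq0 (negPf two_neq0) /=.
move=> /eqP/anisotropic[-> ->].
by apply/rowP => -[[|[|[|[|[|[|//]]]]]] ?]; rewrite !mxE.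
Qed.

Lemma reach_mul W v x :
  x \in G -> {in W, forall f, f .* x = f} -> reach W v (v .* x).
Proof. by exists x. Qed.

(** If neither x1 nor y1 is a pivot, the vector lies in the anisotropic plane
    and is 0. *)
Lemma to_e1_plane x1 y1 a b (v := vec6 x1 y1 0 0 a b) : v != 0 -> dot v v = 0 ->
  exists2 c, c != 0 & reach [:: e2; f2] v (vec6 c 0 0 0 0 0).
Proof.
have sub3 : {subset [:: e2; f2] <= [:: f1; e2; f2]}.
  by move=> f; rewrite !inE orbC => ->; rewrite ?orbT.
move=> nv v0; have [x10|nx1] := eqVneq x1 0; last first.
  by exists x1 => //; apply: reach_sub (pivot_e1_plane nx1 v0).
have [y10|ny1] := eqVneq y1 0.
  by case/eqP: nv; move: v0; rewrite /v x10 y10; apply: singular_w.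
have [z Gz zE] := G_z.
have Rz : reach [:: e2; f2] v (v .* z).
  apply: reach_mul => // f; rewrite !inE.
  by case/orP => /eqP ->; rewrite vec6_z // oppr0.
exists y1 => //; apply: (reach_trans Rz); have := reach_dot Rz.
rewrite v0 (vec6_z _ _ _ _ _ _ zE) => vz0.
by apply: reach_sub (pivot_e1_plane ny1 vz0).
Qed.

Lemma to_e1 v : v != 0 -> dot v v = 0 ->
  exists2 c, c != 0 & reach [::] v (vec6 c 0 0 0 0 0).
Proof.
have [x1 [y1 [x2 [y2 [a [b ->]]]]]] := vec6_eta v => nv v0.
have [z Gz zE] := G_z; have [U GU UE] := G_U.
have fix0 x : {in [::], forall f : V, f .* x = f} by [].
have pivot s t r k d e : s != 0 ->
    dot (vec6 s t r k d e) (vec6 s t r k d e) = 0 ->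
    exists2 c, c != 0 & reach [::] (vec6 s t r k d e) (vec6 c 0 0 0 0 0).
  by move=> ns u0; exists s => //; apply: reach_sub (pivot_e1 ns u0).
have step u x : x \in G -> dot u u = 0 ->
    (dot (u .* x) (u .* x) = 0 ->
     exists2 c, c != 0 & reach [::] (u .* x) (vec6 c 0 0 0 0 0)) ->
    exists2 c, c != 0 & reach [::] u (vec6 c 0 0 0 0 0).
  move=> Gx u0 IH; have R := reach_mul u Gx (fix0 x).
  have [|c nc Rc] := IH; first by rewrite (reach_dot R).
  by exists c => //; apply: reach_trans Rc.
have pivot2 s t r k d e : (s != 0) || (t != 0) ->
    dot (vec6 s t r k d e) (vec6 s t r k d e) = 0 ->
    exists2 c, c != 0 & reach [::] (vec6 s t r k d e) (vec6 c 0 0 0 0 0).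
  case/orP => [ns|nt] u0; first exact: pivot.
  by apply: (step _ z) => //; rewrite (vec6_z _ _ _ _ _ _ zE); apply: pivot.
have [n1|] := boolP ((x1 != 0) || (y1 != 0)); first exact: pivot2.
rewrite negb_or !negbK => /andP[/eqP x10 /eqP y10].
have [n2|] := boolP ((x2 != 0) || (y2 != 0)).
  apply: (step _ U) => //; rewrite (vec6_U _ _ _ _ _ _ UE).
  by apply: pivot2; rewrite !oppr_eq0.
rewrite negb_or !negbK => /andP[/eqP x20 /eqP y20].
by case/eqP: nv; move: v0; rewrite x10 y10 x20 y20; apply: singular_w.
Qed.

Lemma to_e2 v : v != 0 -> dot v v = 0 ->
  exists2 c, c != 0 & reach [::] v (vec6 0 0 c 0 0 0).
Proof.
move=> nv v0; have [c nc R] := to_e1 nv v0; have [U GU UE] := G_U.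
exists c => //; apply: (reach_trans R).
have <- : vec6 c 0 0 0 0 0 .* U = vec6 0 0 c 0 0 0 by rewrite vec6_U // oppr0.
exact: reach_mul.
Qed.

Lemma to_f2 x1 y1 x2 y2 a b (v := vec6 x1 y1 x2 y2 a b) :
  y2 != 0 -> dot v v = 0 -> reach [:: e2] v (vec6 0 0 0 y2 0 0).
Proof.
move=> ny2 v0; have [z Gz zE] := G_z; have [U GU UE] := G_U.
pose u := vec6 y2 x2 (- x1) (- y1) (- a) b.
have pE s t r k d e : vec6 s t r k d e .* (z * U)%g = vec6 (- r) (- k) t s (- d) e.
  by rewrite (repM mxO_rep) mulmxA vec6_z // vec6_U.
have u0 : dot u u = 0 by rewrite -[RHS]v0 !dot_vec6; ring.
have := reachJ (groupM Gz GU) (pivot_e1 ny2 u0).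
by rewrite /= !pE !opprK !oppr0.
Qed.

Lemma to_f1 x1 y1 a b (v := vec6 x1 y1 0 0 a b) :
  y1 != 0 -> dot v v = 0 -> reach [:: e1; e2; f2] v (vec6 0 y1 0 0 0 0).
Proof.
move=> ny1 v0; have [z Gz zE] := G_z; pose u := vec6 y1 x1 0 0 (- a) b.
have u0 : dot u u = 0 by rewrite -[RHS]v0 !dot_vec6; ring.
have := reachJ Gz (pivot_e1_plane ny1 u0).
by rewrite /= !vec6_z // !opprK !oppr0.
Qed.

(** The group of rotations of the anisotropic plane is the image of the torus. *)
Lemma to_w1 a b : a ^+ 2 - w0 * b ^+ 2 = 1 ->
  exists c, exists2 x, x \in G &
    [/\ e1 .* x = c *: e1, f1 .* x = c^-1 *: f1, e2 .* x = e2, f2 .* x = f2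
      & vec6 0 0 0 0 a b .* x = w1].
Proof.
(* Hilbert 90: a + b psi has norm 1, and is l^(q-1) for l = x + y psi. *)
move=> ab1; pose x := if a + 1 == 0 then 0 else a + 1.
pose y := if a + 1 == 0 then 1 else - b; pose N := x ^+ 2 - w0 * y ^+ 2.
have [N0 aE bE] : [/\ N != 0, (x ^+ 2 + w0 * y ^+ 2) / N = a
                    & - (2%:R * x * y) / N = b].
  rewrite /N /x /y; case: (eqVneq (a + 1) 0) => [|na].
    move=> a1; have : w0 * b ^+ 2 = (a + 1) * (a - 1).
      have -> : (a + 1) * (a - 1) = a ^+ 2 - 1 by ring.
      by rewrite -[X in _ - X]ab1; ring.
    rewrite a1 mul0r => /eqP.
    rewrite mulf_eq0 (negPf w0_neq0) expf_eq0 /= => /eqP ->.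
    move/eqP: a1; rewrite addr_eq0 => /eqP ->; split.
    - by rewrite expr1n expr0n /= mulr1 sub0r oppr_eq0.
    - by rewrite !expr1n !expr0n /= mulr1 sub0r add0r invrN mulrN divff.
    - by rewrite mulr0 !mul0r oppr0 mul0r.
  have NE : (a + 1) ^+ 2 - w0 * (- b) ^+ 2 = 2%:R * (a + 1).
    have -> : w0 * (- b) ^+ 2 = a ^+ 2 - 1 by rewrite -ab1; ring.
    by ring.
  have SE : (a + 1) ^+ 2 + w0 * (- b) ^+ 2 = 2%:R * (a + 1) * a.
    have -> : w0 * (- b) ^+ 2 = a ^+ 2 - 1 by rewrite -ab1; ring.
    by ring.
  rewrite NE SE mulf_neq0 //; split=> //.
    by rewrite mulrAC divff ?mul1r ?mulf_neq0.
  by field; rewrite na two_neq0.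
have [g Gg gE] := G_torus N0; rewrite -/N aE bE in gE.
have gK t s : s .* g = t -> t .* g^-1%g = s.
  by move=> <-; rewrite -mulmxA -(repM mxO_rep) mulgV (rep1 mxO_rep) mulmx1.
exists N, g^-1%g; first by rewrite groupV.
split; apply: gK; rewrite ?scale_vec6 gE; vec_check; rewrite ?mulfV ?mulVf //.
Qed.

Lemma mx_of_rows (M : 'M[F]_6) c d e f b :
  [/\ e1 *m M = c *: e1, f1 *m M = d *: f1, e2 *m M = e *: e2, f2 *m M = f *: f2
    & w1 *m M = w1 /\ w2 *m M = b *: w2] ->
  M = mxrows 6 (torus6 c d e f 1 0 0 b).
Proof.
have rowP i l : nth [::] (torus6 1 1 1 1 1 0 0 1) i = l -> (i < 6)%N ->
    delta_mx 0 (inord i) = vec 6 l :> 'rV[F]_6.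
  move=> <- lt_i; apply/rowP => j; rewrite !mxE eqxx /= -val_eqE /= inordK //.
  by case: i lt_i => [|[|[|[|[|[|//]]]]]] _; case: j => [[|[|[|[|[|[|//]]]]]] ?].
case=> M1 M2 M3 M4 [M5 M6]; apply/row_matrixP => i; rewrite !rowE -[i]inord_val.
case: i => [[|[|[|[|[|[|//]]]]]] lt_i];
  rewrite (rowP _ _ erefl) // -/(vec6 _ _ _ _ _ _).
- by rewrite M1 scale_vec6; symmetry; vec_check.
- by rewrite M2 scale_vec6; symmetry; vec_check.
- by rewrite M3 scale_vec6; symmetry; vec_check.
- by rewrite M4 scale_vec6; symmetry; vec_check.
- by rewrite M5; symmetry; vec_check.
- by rewrite M6 scale_vec6; symmetry; vec_check.
Qed.

Lemma dot_scalel c u v : dot (c *: u) v = c * dot u v.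
Proof. by rewrite /dot -!scalemxAl mxE. Qed.

Lemma dot_e1 x1 y1 x2 y2 a b : dot e1 (vec6 x1 y1 x2 y2 a b) = y1.
Proof. by rewrite dot_vec6; ring. Qed.

Lemma dot_f1 x1 y1 x2 y2 a b : dot f1 (vec6 x1 y1 x2 y2 a b) = x1.
Proof. by rewrite dot_vec6; ring. Qed.

Lemma dot_e2 x1 y1 x2 y2 a b : dot e2 (vec6 x1 y1 x2 y2 a b) = y2.
Proof. by rewrite dot_vec6; ring. Qed.

Lemma dot_f2 x1 y1 x2 y2 a b : dot f2 (vec6 x1 y1 x2 y2 a b) = x2.
Proof. by rewrite dot_vec6; ring. Qed.

Lemma dot_w1 x1 y1 x2 y2 a b :
  dot w1 (vec6 x1 y1 x2 y2 a b) = - 2%:R * a.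
Proof. by rewrite dot_vec6; ring. Qed.

Definition dot_coord := (dot_scalel, dot_e1, dot_f1, dot_e2, dot_f2, dot_w1).

(** The images of e2, f2, e1, f1, w1 are corrected in this order; each of
    them is orthogonal to the vectors already in place, or paired with one of
    them.  The image of w2 is then b w2 with b = 1 or -1, and multiplication by
    diag(c, c^-1, c^-1, c, 1, 1) moves the scalar c on e2 to e1. *)
Lemma reduce_isometry g : minus_isometry w0 (mxO g) ->
  exists2 x, x \in G & exists c b, [/\ c != 0, b ^+ 2 = 1
    & mxO (g * x)%g = mxrows 6 (torus6 c c^-1 1 1 1 0 0 b)].
Proof.
move=> isoG.
have dotg x u v : x \in G -> dot (u .* (g * x)%g) (v .* (g * x)%g) = dot u v.
  move=> Gx; rewrite (repM mxO_rep) !mulmxA (dot_isometry _ _ (G_isometry Gx)).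
  exact: dot_isometry.
have actM u x y : u .* (g * (x * y))%g = u .* (g * x)%g .* y.
  by rewrite mulgA (repM mxO_rep (g * x)%g) mulmxA.
have act_scale d u x : (d *: u) .* x = d *: (u .* x) by rewrite scalemxAl.
have dot_neq0 u v : dot u v = 1 -> u != 0.
  move=> uv; apply: contra_eq_neq uv => ->.
  by rewrite /dot !mul0mx mxE eq_sym oner_neq0.
have inv_eq (d k : F) : d != 0 -> d * k = 1 -> k = d^-1.
  by move=> nd dk; apply: (mulfI nd); rewrite dk divff.
have mul0 (d k : F) : d != 0 -> d * k = 0 -> k = 0.
  by move=> nd /eqP; rewrite mulf_eq0 (negPf nd) => /eqP.
have [c nc [x1 Gx1 [x1E _]]] :
    exists2 c, c != 0 & reach [::] (e2 .* g) (vec6 0 0 c 0 0 0).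
  apply: to_e2; last by rewrite dot_isometry // dot_e2.
  by apply: (dot_neq0 _ (f2 .* g)); rewrite dot_isometry // dot_e2.
have {}x1E : e2 .* (g * x1)%g = c *: e2.
  by rewrite (repM mxO_rep) mulmxA x1E scale_vec6 !mulr0 mulr1.
have ncV : c^-1 != 0 by rewrite invr_eq0.
have [x2 Gx2 [x2E x2F]] : exists2 x, x \in G &
    e2 .* (g * x)%g = c *: e2 /\ f2 .* (g * x)%g = c^-1 *: f2.
  have := dotg x1 e2 f2 Gx1; have := dotg x1 f2 f2 Gx1; rewrite x1E.
  case: (vec6_eta (f2 .* (g * x1)%g)) => s [t [r [k [a [b vE]]]]].
  rewrite vE dot_f2 !dot_coord => v0 /(inv_eq _ _ nc) kE; rewrite kE in vE v0.
  have [x Gx [xv xW]] := to_f2 ncV v0.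
  exists (x1 * x)%g; first exact: groupM.
  rewrite !actM x1E vE act_scale xW ?mem_head // xv.
  by split=> //; rewrite [in RHS]scale_vec6 !mulr0 mulr1.
have [c1 nc1 [x3 Gx3 [x3e x3f x3E]]] : exists2 c1, c1 != 0 & exists2 x, x \in G &
    [/\ e2 .* (g * x)%g = c *: e2, f2 .* (g * x)%g = c^-1 *: f2
      & e1 .* (g * x)%g = c1 *: e1].
  have := dotg x2 e2 e1 Gx2; have := dotg x2 f2 e1 Gx2.
  have := dotg x2 e1 e1 Gx2; have := dotg x2 e1 f1 Gx2; rewrite x2E x2F.
  case: (vec6_eta (e1 .* (g * x2)%g)) => s [t [r [k [a [b vE]]]]].
  rewrite vE !dot_coord => /dot_neq0 nv v0 /(mul0 _ _ ncV) r0 /(mul0 _ _ nc) k0.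
  rewrite r0 k0 in vE nv v0.
  have [c1 nc1 [x Gx [xv xW]]] := to_e1_plane nv v0.
  exists c1 => //; exists (x2 * x)%g; first exact: groupM.
  rewrite !actM x2E x2F vE !act_scale xv (xW e2) ?(xW f2) ?inE ?eqxx ?orbT //.
  by split=> //; rewrite [in RHS]scale_vec6 !mulr0 mulr1.
have nc1V : c1^-1 != 0 by rewrite invr_eq0.
have [x4 Gx4 [x4e x4f x4E x4F]] : exists2 x, x \in G &
    [/\ e2 .* (g * x)%g = c *: e2, f2 .* (g * x)%g = c^-1 *: f2,
        e1 .* (g * x)%g = c1 *: e1 & f1 .* (g * x)%g = c1^-1 *: f1].
  have := dotg x3 e2 f1 Gx3; have := dotg x3 f2 f1 Gx3.
  have := dotg x3 e1 f1 Gx3; have := dotg x3 f1 f1 Gx3; rewrite x3e x3f x3E.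
  case: (vec6_eta (f1 .* (g * x3)%g)) => s [t [r [k [a [b vE]]]]].
  rewrite vE !dot_coord.
  move=> v0 /(inv_eq _ _ nc1) tE /(mul0 _ _ ncV) r0 /(mul0 _ _ nc) k0.
  rewrite r0 k0 tE in vE v0.
  have [x Gx [xv xW]] := to_f1 nc1V v0.
  exists (x3 * x)%g; first exact: groupM.
  rewrite !actM x3e x3f x3E vE !act_scale xv.
  rewrite (xW e1) ?(xW e2) ?(xW f2) ?inE ?eqxx ?orbT //.
  by split=> //; rewrite [in RHS]scale_vec6 !mulr0 mulr1.
have [c2 [x5 Gx5 [x5e x5f x5E x5F x5w]]] : exists c2, exists2 x, x \in G &
    [/\ e2 .* (g * x)%g = c *: e2, f2 .* (g * x)%g = c^-1 *: f2,
        e1 .* (g * x)%g = c2 *: e1, f1 .* (g * x)%g = c2^-1 *: f1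
      & w1 .* (g * x)%g = w1].
  have := dotg x4 e2 w1 Gx4; have := dotg x4 f2 w1 Gx4; have := dotg x4 e1 w1 Gx4.
  have := dotg x4 f1 w1 Gx4; have := dotg x4 w1 w1 Gx4; rewrite x4e x4f x4E x4F.
  case: (vec6_eta (w1 .* (g * x4)%g)) => s [t [r [k [a [b vE]]]]].
  rewrite vE !dot_coord => v0 /(mul0 _ _ nc1V) s0 /(mul0 _ _ nc1) t0.
  move=> /(mul0 _ _ ncV) r0 /(mul0 _ _ nc) k0; rewrite s0 t0 r0 k0 in vE v0.
  have ab1 : a ^+ 2 - w0 * b ^+ 2 = 1.
    have n2 : - 2%:R != 0 :> F by rewrite oppr_eq0.
    by apply: (mulfI n2); rewrite -dot_w v0.
  have [c2 [x Gx [xe xf xE xF xw]]] := to_w1 ab1.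
  exists (c1 * c2), (x4 * x)%g; first exact: groupM.
  by rewrite !actM x4e x4f x4E x4F vE !act_scale xe xf xE xF xw !scalerA invfM.
have nc2 : c2 != 0.
  have := dotg x5 e1 f1 Gx5; rewrite x5E dot_scalel dot_e1.
  by apply: contra_eq_neq => ->; rewrite mul0r eq_sym oner_neq0.
have nc2V : c2^-1 != 0 by rewrite invr_eq0.
have [b b1 x5v] : exists2 b, b ^+ 2 = 1 & w2 .* (g * x5)%g = b *: w2.
  have := dotg x5 e2 w2 Gx5; have := dotg x5 f2 w2 Gx5; have := dotg x5 e1 w2 Gx5.
  have := dotg x5 f1 w2 Gx5; have := dotg x5 w1 w2 Gx5; have := dotg x5 w2 w2 Gx5.
  rewrite x5e x5f x5E x5F x5w.
  case: (vec6_eta (w2 .* (g * x5)%g)) => s [t [r [k [a [b vE]]]]].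
  have n2 : - 2%:R != 0 :> F by rewrite oppr_eq0.
  rewrite vE !dot_coord mulr0.
  move=> v0 /(mul0 _ _ n2) a0 /(mul0 _ _ nc2V) s0 /(mul0 _ _ nc2) t0.
  move=> /(mul0 _ _ ncV) r0 /(mul0 _ _ nc) k0; rewrite a0 s0 t0 r0 k0 in vE v0 *.
  exists b; last by rewrite scale_vec6 !mulr0 mulr1.
  move: v0; rewrite !dot_w expr1n => /(mulfI n2)/addrI/oppr_inj.
  exact: mulfI.
have gx5 := mx_of_rows (And5 x5E x5F x5e x5f (conj x5w x5v)).
have [x Gx xE] := G_d ncV; exists (x5 * x)%g; first exact: groupM.
exists (c2 * c), b; split; rewrite ?mulf_neq0 //.
rewrite mulgA (repM mxO_rep) gx5 xE invrK invfM.
by rows_check; rewrite ?mulVf ?divff.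
Qed.

Variable SO : {group gO}.
Hypothesis SO_P : forall x,
  reflect (minus_isometry w0 (mxO x) /\ \det (mxO x) = 1) (x \in SO).
Hypothesis G_sub_SO : G \subset SO.

Definition has_torus_form (k : gO) (c : F) :=
  mxO k = mxrows 6 (torus6 c c^-1 1 1 1 0 0 1).

Lemma reduce_SO g : g \in SO ->
  exists2 x, x \in G & exists2 c, c != 0 & has_torus_form (g * x)%g c.
Proof.
move=> SOg; have [isoG _] := SO_P _ SOg.
have [x Gx [c [b [nc b1 gxE]]]] := reduce_isometry isoG.
exists x => //; exists c => //; rewrite /has_torus_form gxE.
have /SO_P[_] : (g * x)%g \in SO by rewrite groupM // (subsetP G_sub_SO).
rewrite gxE det_trig; first last.
  apply/is_trig_mxP => i j; rewrite mxrowsE.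
  by case: i j => [[|[|[|[|[|[|//]]]]]] ?] [[|[|[|[|[|[|//]]]]]] ?].
rewrite !big_ord_recr big_ord0 /= !mxrowsE /entry /=.
by rewrite !mulr1 mul1r mulfV // mul1r => ->.
Qed.

Lemma torus_formM k k' c c' : has_torus_form k c -> has_torus_form k' c' ->
  has_torus_form (k * k')%g (c * c').
Proof.
rewrite /has_torus_form (repM mxO_rep) invfM => -> ->.
by rows_check; rewrite // mulrC.
Qed.

(** This is the image of diag(a^-1, a, a, a^-1) for a = w0^-j. *)
Lemma torus_form_square k j : has_torus_form k (w0 ^+ j.*2) -> k \in G.
Proof.
have nj : (w0 ^- j) != 0 by rewrite invr_eq0 expf_neq0.
have w00 : w0 * 0 ^+ 2 = 0 by rewrite expr0n mulr0.
have N0 : (w0 ^- j) ^+ 2 - w0 * 0 ^+ 2 != 0 by rewrite w00 subr0 expf_neq0.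
have [x Gx] := G_torus N0.
rewrite w00 subr0 addr0 !mulr0 oppr0 mul0r divff ?expf_neq0 //.
move=> xE kE; suff -> : k = x by [].
by apply: (rep_inj mxO_rep); rewrite kE xE exprVn invrK -exprM muln2.
Qed.

(** F* is generated by w0, so that SO is the union of G and one coset; a
    subgroup of index 2 is normal with abelian quotient. *)
Lemma derived_SO_sub : [~: SO, SO]%g \subset G.
Proof.
rewrite -derg1; have [sSG | /subsetPn[g0 SOg0 G'g0]] := boolP (SO \subset G).
  exact: subset_trans (der_sub 1 SO) sSG.
have torus_exp g : g \in SO ->
    exists2 x, x \in G & exists j, has_torus_form (g * x)%g (w0 ^+ j).
  move=> /reduce_SO[x Gx [c nc gxE]]; have [j cE] := w0_generates nc.
  by exists x => //; exists j; rewrite -cE.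
have [x0 Gx0 [j0 g0E]] := torus_exp _ SOg0.
pose k0 := (g0 * x0)%g.
have SOk0 : k0 \in SO by rewrite groupM // (subsetP G_sub_SO).
(* Two elements of SO outside G have odd exponents, so that the product of
   their torus forms is the square of a torus form, and lies in G. *)
have odd_j0 : odd j0.
  apply: contraR G'g0 => even_j0; rewrite -(groupMr _ Gx0).
  by apply: (@torus_form_square _ j0./2); rewrite even_halfK.
have cover : SO \subset G :|: (k0^-1 *: G)%g.
  apply/subsetP => g SOg; have [x Gx [j gE]] := torus_exp _ SOg.
  rewrite inE mem_lcoset invgK -(groupMr g Gx) -(groupMr (k0 * g)%g Gx) -mulgA.
  have [odd_j | even_j] := boolP (odd j); apply/orP; [right | left].
    apply: (@torus_form_square _ (j0 + j)./2).
    rewrite even_halfK ?oddD ?odd_j0 ?odd_j //.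
    by rewrite exprD; apply: torus_formM.
  by apply: (@torus_form_square _ j./2); rewrite even_halfK.
have index2 : #|SO : G|%g = 2.
  apply/eqP; rewrite eqn_leq indexg_gt1 andbC; apply/andP; split.
    by apply/subsetPn; exists g0.
  rewrite -(leq_pmul2l (cardG_gt0 G)) Lagrange // muln2 -addnn.
  apply: leq_trans (subset_leq_card cover) _.
  by rewrite (leq_trans (leq_card_setU _ _)) // card_lcoset.
have nG := index2_normal G_sub_SO index2.
apply: der1_min (normal_norm nG) _.
apply: cyclic_abelian; apply: prime_cyclic.
by rewrite card_quotient ?normal_norm // index2.
Qed.

End Elimination.

(** * The matrices of the generators *)

Section Generators.
Variables (F K : finFieldType) (iota : {rmorphism F -> K}).
Hypotheses (q_odd : odd #|F|) (card_K : #|K| = (#|F| ^ 2)%N).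
Variables (w : K) (w0 A B C : F).
Hypothesis w_prim : primitive_element w.
Local Notation q := #|F|.
Local Notation psi := (w ^+ (q.+1)./2).
Hypotheses (w0_def : iota w0 = w ^+ q.+1)
  (A_def : iota A = (w ^+ q.-1 + w ^- q.-1) / 2%:R)
  (B_def : iota B = psi * (w ^- q.-1 - w ^+ q.-1) / 2%:R)
  (C_def : iota C = psi^-1 * (w ^- q.-1 - w ^+ q.-1) / 2%:R).

Let w_neq0 := w_neq0 q_odd card_K w_prim.
Let psi_neq0 := psi_neq0 q_odd card_K w_prim.
Let psi2 := psi2 q_odd w0_def.
Let psi_q := psi_frobenius q_odd card_K w_prim w0_def.
Let two_neq0 := two_neq0 iota q_odd.
Let w0_neq0 := w0_neq0 q_odd card_K w_prim w0_def.
Let frobK := frobeniusK card_K.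

Local Notation covers := (covers iota psi).
Local Notation Ogens := (Omega_gens w0 A B C).
Local Notation Ugens := (SU4_gens q w).

Let two_neq0F : 2%:R != 0 :> F.
Proof. by rewrite -(fmorph_eq0 iota) rmorph_nat. Qed.

Lemma expw_pred : w ^+ q.-1 = w ^+ q / w.
Proof.
apply: (mulIf w_neq0); rewrite -exprSr divfK // prednK //.
by have := card_F_gt2 q_odd; case: #|F|.
Qed.

Lemma expw_predV : w ^- q.-1 = w / w ^+ q.
Proof. by rewrite expw_pred invf_div. Qed.

Let wq_neq0 : w ^+ q != 0. Proof. exact: expf_neq0. Qed.

Lemma iota_w0 : iota w0 = w * w ^+ q.
Proof. by rewrite w0_def exprS. Qed.

(** On the plane of w1, w2, delta is multiplication by w^(q-1), of norm 1:
    this is the relation A^2 - w0 C^2 = 1, with B = w0 C. *)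
Lemma orthogonal_delta :
  minus_isometry w0 (mxrows 6 (torus6 w0^-1 w0 1 1 A (- C) (- B) A)).
Proof.
have BC : B = w0 * C.
  apply: (fmorph_inj iota); rewrite rmorphM /= B_def C_def -psi2.
  by rewrite !mulrA expr2 mulfK.
have A2 : A ^+ 2 - w0 * C ^+ 2 = 1.
  apply: (fmorph_inj iota); rewrite rmorphB rmorphXn rmorphM rmorphXn rmorph1 /=.
  rewrite A_def C_def -psi2 expw_predV expw_pred.
  move: psi_neq0 two_neq0 w_neq0 wq_neq0.
  generalize (w ^+ (q.+1)./2) (w ^+ q) => p v p0 t0 wn0 v0.
  by field; rewrite p0 t0 wn0 v0.
apply: orthogonal_torus6; rewrite ?mulVf ?mulr1 ?sqrrN // BC.
- by ring.
- by rewrite -[RHS]mulr1 -A2; ring.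
Qed.

Definition Ogen (i : nat) : {'GL_6[F]} := tnth Ogens (inord i).

Lemma Omega_gensE :
  [/\ GLval (Ogen 0) = mxrows 6 (sigma_rows 1),
      GLval (Ogen 1) = mxrows 6 (tau_rows w0 1 0),
      GLval (Ogen 2) = mxrows 6 (torus6 w0^-1 w0 1 1 A (- C) (- B) A),
      GLval (Ogen 3) = mxrows 6 (z_rows F)
    & GLval (Ogen 4) = mxrows 6 (U_rows F)].
Proof.
have unit_of M : minus_isometry w0 M -> M \in unitmx.
  by apply: orthogonal_unit; rewrite ?two_neq0F.
have tauE : tau_rows w0 1 0 = [:: [:: 1; 1; 0; 0; 1; 0]; [:: 0; 1; 0; 0; 0; 0];
                 [:: 0; 0; 1; 0; 0; 0]; [:: 0; 0; 0; 1; 0; 0];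
                 [:: 0; 2%:R; 0; 0; 1; 0]; [:: 0; 0; 0; 0; 0; 1]].
  by rewrite /tau_rows expr1n expr0n !mulr0 subr0 mulr1 oppr0.
rewrite /Ogen !(tnth_nth 1%g) !inordK //; split.
- by apply: GLrowsE; apply/unit_of/orthogonal_sigma.
- by rewrite tauE; apply: GLrowsE; rewrite -tauE; apply/unit_of/orthogonal_tau.
- by apply: GLrowsE; apply/unit_of/orthogonal_delta.
- by apply: GLrowsE; apply/unit_of/orthogonal_z.
- by apply: GLrowsE; apply/unit_of/orthogonal_U.
Qed.

Definition Ugen (i : nat) : {'GL_4[K]} := tnth Ugens (inord i).

Lemma SU4_gensE :
  [/\ GLval (Ugen 0) = mxrows 4 (elem_s 1 1),
      GLval (Ugen 1) = mxrows 4 (elem_t (- psi)) &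
      GLval (Ugen 2) = mxrows 4 (weyl_z psi)] /\
  [/\ GLval (Ugen 3) = mxrows 4 (torus4 (iota w0)^-1 (iota w0) 1 1),
      GLval (Ugen 4) = mxrows 4 (torus4 w^-1 (w ^+ q) w (w ^+ q)^-1)
    & GLval (Ugen 5) = mxrows 4 (weyl_u K)].
Proof.
have unit_of M : unitary q M -> M \in unitmx by apply: unitary_unit.
have tq : (- psi) ^+ q = - - psi by rewrite frobeniusN // psi_q.
have w0q : iota w0 ^+ q = iota w0 by rewrite frobenius_base.
have w0i : iota w0 != 0 by rewrite fmorph_eq0.
rewrite /Ugen !(tnth_nth 1%g) !inordK //; split; split; rewrite ?w0_def;
  apply: GLrowsE; apply: unit_of.
- by have := unitary_s q_odd frobK 1; rewrite expr1n.
- exact: unitary_t.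
- exact: unitary_z.
- rewrite -w0_def; apply: (unitary_torus q_odd);
  by rewrite // ?exprVn ?w0q ?expr1n ?mulr1 ?mulVf ?mulfV.
- by apply: (unitary_torus q_odd); rewrite // ?exprVn ?frobK ?mulVf ?mulfV.
- exact: unitary_u.
Qed.

End Generators.

Lemma negI4E (K : finFieldType) : GLval (negI4 K) = - 1%:M.
Proof.
have -> : - 1%:M = mxrows 4 (torus4 (-1) (-1) (-1) (-1)) :> 'M[K]_4.
  apply: (addIr 1%:M); rewrite addNr mxrows1; apply/matrixP => i j.
  by rewrite !mxE; case: i j => [[|[|[|[|//]]]] ?] [[|[|[|[|//]]]] ?];
  rewrite /= /entry /= ?addNr ?addr0.
apply: GLrowsE; rewrite unitmxE.
rewrite [mxrows _ _](_ : _ = mxrows 4 (torus4 (-1) (-1) (-1) (-1))) //.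
by rewrite det_torus4 !mulrN1 !opprK unitr1.
Qed.

(** * The isomorphism and its consequences *)

Section Isomorphism.
Variables (F K : finFieldType) (iota : {rmorphism F -> K}).
Hypotheses (q_odd : odd #|F|) (card_K : #|K| = (#|F| ^ 2)%N).
Variables (w : K) (w0 A B C : F).
Hypothesis w_prim : primitive_element w.
Local Notation q := #|F|.
Local Notation psi := (w ^+ (q.+1)./2).
Hypotheses (w0_def : iota w0 = w ^+ q.+1)
  (A_def : iota A = (w ^+ q.-1 + w ^- q.-1) / 2%:R)
  (B_def : iota B = psi * (w ^- q.-1 - w ^+ q.-1) / 2%:R)
  (C_def : iota C = psi^-1 * (w ^- q.-1 - w ^+ q.-1) / 2%:R).

Let w_neq0 := w_neq0 q_odd card_K w_prim.
Let psi_neq0 := psi_neq0 q_odd card_K w_prim.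
Let psi2 := psi2 q_odd w0_def.
Let psi_q := psi_frobenius q_odd card_K w_prim w0_def.
Let two_neq0 := two_neq0 iota q_odd.
Let w0_neq0 := w0_neq0 q_odd card_K w_prim w0_def.
Let frobK := frobeniusK card_K.

Local Notation covers := (covers iota psi).

Let iota_w0 := iota_w0 w0_def.
Let expw_pred := expw_pred q_odd card_K w_prim.
Let expw_predV := expw_predV q_odd card_K w_prim.
Let wq_neq0 : w ^+ q != 0. Proof. exact: expf_neq0. Qed.
Variables (gO gU : finGroupType) (mxO : gO -> 'M[F]_6) (mxU : gU -> 'M[K]_4).
Hypotheses (mxO_rep : faithful_rep mxO) (mxU_rep : faithful_rep mxU).
Variables (Ogens : 5.-tuple gO) (Ugens : 6.-tuple gU).
Local Notation Ogen i := (tnth Ogens (inord i)).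
Local Notation Ugen i := (tnth Ugens (inord i)).
Hypothesis Omega_gensE :
  [/\ mxO (Ogen 0) = mxrows 6 (sigma_rows 1),
      mxO (Ogen 1) = mxrows 6 (tau_rows w0 1 0),
      mxO (Ogen 2) = mxrows 6 (torus6 w0^-1 w0 1 1 A (- C) (- B) A),
      mxO (Ogen 3) = mxrows 6 (z_rows F)
    & mxO (Ogen 4) = mxrows 6 (U_rows F)].
Hypothesis SU4_gensE :
  [/\ mxU (Ugen 0) = mxrows 4 (elem_s 1 1),
      mxU (Ugen 1) = mxrows 4 (elem_t (- psi)) &
      mxU (Ugen 2) = mxrows 4 (weyl_z psi)] /\
  [/\ mxU (Ugen 3) = mxrows 4 (torus4 (iota w0)^-1 (iota w0) 1 1),
      mxU (Ugen 4) = mxrows 4 (torus4 w^-1 (w ^+ q) w (w ^+ q)^-1)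
    & mxU (Ugen 5) = mxrows 4 (weyl_u K)].

Definition subst_letters : 6.-tuple (freegroup 'I_5) :=
  let l i := tnth (letters 5) (inord i) in
  [tuple ((l 1%N)^-1)%g; l 0%N; l 4%N; (l 2%N * (l 2%N)^-1 ^ l 4%N)%g; l 2%N;
         (l 3%N * l 4%N ^+ 2)%g].

Definition subst_gens : 6.-tuple gO :=
  [tuple fgeval Ogens (tnth subst_letters i) | i < 6].

Lemma fgeval_subst v : fgeval Ogens (subst v) = fgeval subst_gens v.
Proof. exact: fgeval_comp. Qed.

Definition lifts (g : gU) (h : gO) := covers (mxU g) (mxO h).

Lemma liftsM g g' h h' : lifts g h -> lifts g' h' -> lifts (g * g')%g (h * h')%g.
Proof.
by move=> H H'; rewrite /lifts (repM mxU_rep) (repM mxO_rep); apply: coversM.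
Qed.

Lemma lifts1 : lifts 1%g 1%g.
Proof. by rewrite /lifts (rep1 mxU_rep) (rep1 mxO_rep); apply: covers1. Qed.

Lemma liftsV g h : lifts g h -> lifts (g^-1)%g (h^-1)%g.
Proof.
have [[_ _ uU] [_ _ uO]] := (mxU_rep, mxO_rep).
by rewrite /lifts (repV mxU_rep) (repV mxO_rep); apply: coversV.
Qed.

Lemma lifts_inj g h h' : lifts g h -> lifts g h' -> h = h'.
Proof. by move=> H H'; apply: (rep_inj mxO_rep); apply: covers_inj H H'. Qed.

Lemma mxU_zV : mxU (Ugen 2)^-1%g = mxrows 4 (weyl_z (- psi)).
Proof.
have [[_ _ U2] _] := SU4_gensE.
apply: (repV_eq mxU_rep); rewrite U2.
by rows_check; rewrite ?invrN ?mulrN ?opprK ?divff ?mulVf.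
Qed.

(** The image of d is imposed by the relation d = [D^-1, z]; the other letters
    are compared directly with their images. *)
Lemma lifts_subst_gens i : lifts (tnth Ugens i) (tnth subst_gens i).
Proof.
have [O0 O1 O2 O3 O4] := Omega_gensE.
have [[U0 U1 U2] [U3 U4 U5]] := SU4_gensE.
have l0 : lifts (Ugen 0) (Ogen 1)^-1%g.
  have : lifts (Ugen 0)^-1%g (Ogen 1).
    rewrite /lifts; have -> : mxU (Ugen 0)^-1%g = mxrows 4 (elem_s (-1) (-1)).
      by apply: (repV_eq mxU_rep); rewrite U0; rows_check; rewrite ?addNr ?addrN.
    rewrite O1; have := covers_s psi_neq0 psi2 1 0.
    by rewrite rmorph0 rmorph1 !mulr0 !sub0r.
  by move/liftsV; rewrite invgK.
have l1 : lifts (Ugen 1) (Ogen 0).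
  rewrite /lifts U1 O0; have := covers_t iota psi_neq0 1.
  by rewrite rmorph1 mulr1.
have l2 : lifts (Ugen 2) (Ogen 4).
  by rewrite /lifts U2 O4; apply: covers_z.
have l4 : lifts (Ugen 4) (Ogen 2).
  rewrite /lifts U4 O2.
  apply: (covers_delta psi_neq0 psi2 two_neq0); rewrite ?iota_w0 //.
  - by rewrite A_def expw_predV expw_pred.
  - by rewrite B_def expw_predV expw_pred.
  - by rewrite C_def expw_predV expw_pred.
have l3 : lifts (Ugen 3) (Ogen 2 * (Ogen 2)^-1 ^ Ogen 4)%g.
  suff -> : Ugen 3 = (Ugen 4 * (Ugen 4)^-1 ^ Ugen 2)%g.
    rewrite conjgE.
    exact: (liftsM l4 (liftsM (liftsV l2) (liftsM (liftsV l4) l2))).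
  apply: (mulIg ((Ugen 2)^-1 * Ugen 4)%g).
  rewrite conjgE -!mulgA mulKVg mulVg mulg1; apply: (rep_inj mxU_rep).
  have id1 (l m p : K) : l != 0 -> m != 0 -> (l * m)^-1 * (p * m) = l^-1 * p.
    by move=> nl nm; field; rewrite nl nm.
  have id2 (l m p : K) : l != 0 -> p != 0 -> l * m * (p^-1 / l) = m / p.
    by move=> nl np; field; rewrite nl np.
  rewrite !(repM mxU_rep) mxU_zV U3 U4 iota_w0.
  by rows_check; rewrite ?id1 ?id2 ?oppr_eq0.
have l5 : lifts (Ugen 5) (Ogen 3 * Ogen 4 ^+ 2)%g.
  rewrite /lifts expgS expg1 !(repM mxO_rep) U5 O3 O4.
  rewrite (_ : _ *m _ = mxrows 6 (u_rows F)); first exact: covers_u.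
  by rows_check.
have -> : i = inord i by rewrite inord_val.
have fE j : fgeval Ogens (tnth (letters 5) (inord j)) = Ogen j.
  exact: fgeval_letter.
rewrite [X in lifts _ X]tnth_mktuple (tnth_nth 1%g subst_letters) inordK //.
case: i => [[|[|[|[|[|[|//]]]]]] lt_i] /=;
  by rewrite ?fgevalM ?fgevalJ ?fgevalV ?fgevalX !fE.
Qed.

Lemma lifts_words v : lifts (fgeval Ugens v) (fgeval subst_gens v).
Proof.
rewrite /fgeval; elim: (fgword v) => [|a s IHs].
  by rewrite !big_nil; apply: lifts1.
rewrite !big_cons; apply: liftsM IHs; case: a.2; last exact: lifts_subst_gens.
exact/liftsV/lifts_subst_gens.
Qed.

Variables (m : int) (RSL RPSL : freegroup 'I_3 -> Prop).
Local Notation rels := (SU4_relators q m RSL RPSL).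
Variables (SU : {set gU}) (negI : gU).
Hypotheses (negIE : mxU negI = - 1%:M)
  (SU_lift : forall N, unitary q N -> \det N = 1 ->
     exists2 g, g \in SU & mxU g = N).
Local Notation SU4_mod_gens := [tuple of map (coset <[negI]>%g) Ugens].
Hypothesis SU4_pres : presents rels (SU / <[negI]>)%g SU4_mod_gens.

Lemma lifts_negI4 g : g \in <[negI]>%g -> lifts g 1%g.
Proof.
case/cycleP => k ->; elim: k => [|k IHk]; first exact: lifts1.
rewrite expgS -[1%g]mulg1; apply: liftsM IHk.
by rewrite /lifts negIE (rep1 mxO_rep); apply/coversN/covers1.
Qed.

Lemma lifts_ker g : lifts g 1%g -> g \in <[negI]>%g.
Proof.
rewrite /lifts (rep1 mxO_rep) => /(covers_ker psi_neq0 two_neq0)[g1 | gN].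
  rewrite (_ : g = 1%g) ?group1 //.
  by apply: (rep_inj mxU_rep); rewrite (rep1 mxU_rep).
by rewrite (_ : g = negI) ?cycle_id //; apply: (rep_inj mxU_rep); rewrite gN negIE.
Qed.

(** -1 is central. *)
Lemma norm_negI4 g : g \in 'N(<[negI]>)%g.
Proof.
apply: (subsetP (cent_sub _)); rewrite cent_cycle; apply/cent1P.
apply: (rep_inj mxU_rep).
by rewrite !(repM mxU_rep) negIE mulmxN mulNmx mulmx1 mul1mx.
Qed.

Lemma fgeval_SU4_mod v :
  fgeval SU4_mod_gens v = coset <[negI]>%g (fgeval Ugens v).
Proof.
have [_ <-] := fgeval_morph (coset_morphism <[negI]>%g) v
  (fun i => norm_negI4 (tnth Ugens i)).
by [].
Qed.

Lemma SU4_mod_relP v : fgeval Ogens (subst v) = 1%g <-> fgeval SU4_mod_gens v = 1%g.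
Proof.
rewrite fgeval_subst fgeval_SU4_mod; have lv := lifts_words v; split=> [v1 | v1].
  by apply: coset_id; apply: lifts_ker; rewrite -v1.
apply: lifts_inj lv _; apply: lifts_negI4.
by apply: coset_idr v1; apply: norm_negI4.
Qed.

(** A right inverse of the substitution: tau = s^-1, sigma = t, delta = D,
    z = u z^-2 and U' = z. *)
Definition lift_word : freegroup 'I_5 -> freegroup 'I_6 :=
  let l i := tnth (letters 6) (inord i) in
  fgeval [tuple l 1%N; ((l 0%N)^-1)%g; l 4%N; (l 5%N * (l 2%N) ^- 2)%g; l 2%N].

Lemma substE v : subst v = fgeval subst_letters v. Proof. by []. Qed.

Lemma lift_wordK : cancel lift_word subst.
Proof.
move=> v; rewrite -[RHS]fgeval_letters substE [LHS]fgeval_comp.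
congr fgeval; apply: eq_from_tnth => i; rewrite tnth_mktuple.
have lE j : fgeval subst_letters (tnth (letters 6) (inord j)) =
  tnth subst_letters (inord j) by apply: fgeval_letter.
have -> : i = inord i by rewrite inord_val.
rewrite (tnth_nth 1%g) inordK //.
case: i => [[|[|[|[|[|//]]]]] lt_i] /=; rewrite ?fgevalM ?fgevalV ?fgevalX !lE.
all: by rewrite !(tnth_nth 1%g subst_letters) !inordK //= ?invgK ?mulgK.
Qed.

Lemma Omega_relP v :
  fgeval Ogens v = 1%g <-> normal_closure (image_rel subst rels) v.
Proof.
split=> [v1 | ].
  rewrite -(lift_wordK v); apply: normal_closure_image;
    [exact: fgeval1 | exact: fgevalM | exact: fgevalV |].
  by apply/(SU4_pres.2)/SU4_mod_relP; rewrite lift_wordK.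
elim=> {v} [_ [v Rv ->]||x y _ Ix _ Iy|x _ Ix|x y _ Ix].
- by apply/SU4_mod_relP/(SU4_pres.2)/NclRel.
- exact: fgeval1.
- by rewrite fgevalM Ix Iy mulg1.
- by rewrite fgevalV Ix invg1.
- by rewrite fgevalJ Ix conj1g.
Qed.

Local Notation G := <<[set:: Ogens]>>%G.

Lemma fgeval_subst_gens_in v : fgeval subst_gens v \in G.
Proof. by rewrite -fgeval_subst fgeval_gen. Qed.

(** By the presentation, every element of SU(4,q) is a word in the letters
    up to sign. *)
Lemma SU4_lifts g : g \in SU -> exists2 h, h \in G & lifts g h.
Proof.
move=> SUg; have : coset <[negI]>%g g \in (SU / <[negI]>)%g.
  exact: (mem_morphim (coset_morphism _) (norm_negI4 g) SUg).
rewrite -SU4_pres.1 => /gen_fgeval[v]; rewrite fgeval_SU4_mod => eq_gv.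
exists (fgeval subst_gens v); first exact: fgeval_subst_gens_in.
have Zg : (g * (fgeval Ugens v)^-1 \in <[negI]>)%g.
  rewrite -mem_rcoset; apply/(rcoset_kercosetP (norm_negI4 _) (norm_negI4 _)).
  exact: eq_gv.
rewrite -[g](mulgKV (fgeval Ugens v)) -[fgeval subst_gens v]mul1g.
by apply: liftsM (lifts_words v); apply: lifts_negI4.
Qed.

(** Every explicit element of SU(4,q) yields, through its action on
    alternating matrices, an explicit element of G. *)
Lemma in_G N M : unitary q N -> \det N = 1 -> covers N M ->
  exists2 h, h \in G & mxO h = M.
Proof.
move=> uN dN cNM; have [g SUg gN] := SU_lift uN dN.
have [h Gh lgh] := SU4_lifts SUg; exists h => //.
by apply: (covers_inj psi_neq0 two_neq0) cNM; rewrite -gN.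
Qed.

Definition derived_lift g := exists2 h, h \in G^`(1)%g & lifts g h.

Lemma derived_liftM g g' :
  derived_lift g -> derived_lift g' -> derived_lift (g * g')%g.
Proof.
move=> [h Gh lh] [h' Gh' lh']; exists (h * h')%g; first exact: groupM.
exact: liftsM.
Qed.

Lemma derived_liftV g : derived_lift g -> derived_lift g^-1%g.
Proof. by case=> h Gh lh; exists h^-1%g; [rewrite groupV | apply: liftsV]. Qed.

Lemma derived_liftJ g g' h' : h' \in G -> lifts g' h' ->
  derived_lift g -> derived_lift (g ^ g')%g.
Proof.
move=> Gh' lh' [h Gh lh]; exists (h ^ h')%g.
  by rewrite memJ_norm // (subsetP (der_norm 1 G)).
by rewrite !conjgE; exact: (liftsM (liftsV lh') (liftsM lh lh')).
Qed.

Lemma derived_liftR g g' h h' :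
  h \in G -> h' \in G -> lifts g h -> lifts g' h' -> derived_lift [~ g, g']%g.
Proof.
move=> Gh Gh' lh lh'; exists [~ h, h']%g; first by rewrite derg1 mem_commg.
rewrite !commgEl !conjgE.
exact: (liftsM (liftsV lh) (liftsM (liftsV lh') (liftsM lh lh'))).
Qed.

Lemma subst_gens_in i : tnth subst_gens i \in G.
Proof. by rewrite -(fgeval_letter subst_gens) fgeval_subst_gens_in. Qed.

Lemma commg_eq (gT : finGroupType) (x y c : gT) :
  (y * x * c = x * y)%g -> c = [~ x, y]%g.
Proof.
by move=> e; apply: (mulgI (y * x)%g); rewrite e commgEl conjgE -!mulgA !mulKVg.
Qed.

(** Conjugation by D multiplies the parameter l by w^2, which is not 1:
    s(l) = [s(y), D] for y = l / (w^2 - 1). *)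
Lemma derived_lift_s (l : K) g :
  mxU g = mxrows 4 (elem_s l (l ^+ q)) -> derived_lift g.
Proof.
move=> gE; pose y := l / (w ^+ 2 - 1).
have w21 := w2_neq1 q_odd card_K w_prim.
have [g' SUg' g'E] := SU_lift (unitary_s q_odd frobK y) (det_s _ _).
have [h' Gh' lh'] := SU4_lifts SUg'.
have [_ [U3 U4 U5]] := SU4_gensE.
rewrite (@commg_eq _ g' (Ugen 4) g).
  exact: (derived_liftR Gh' (subst_gens_in _) lh' (lifts_subst_gens _)).
apply: (rep_inj mxU_rep).
have lE : l = y * (w ^+ 2 - 1) by rewrite /y divfK.
have lqE : l ^+ q = y ^+ q * ((w ^+ q) ^+ 2 - 1).
  by rewrite {1}lE exprMn frobeniusD // frobeniusN // expr1n exprAC.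
rewrite !(repM mxU_rep) U4 g'E gE lqE lE.
have id1 (x v : K) : v != 0 -> v^-1 * (x * (v ^+ 2 - 1)) + v^-1 * x = x * v.
  by move=> nv; field; rewrite nv.
by rows_check; rewrite // -?opprD ?[_ * y ^+ q + _]addrC id1.
Qed.

(** Likewise D multiplies the parameter of t by w0, which is not 1. *)
Lemma derived_lift_t : derived_lift (Ugen 1).
Proof.
have [[_ U1 _] [_ U4 _]] := SU4_gensE.
have w01 := w0_neq1 q_odd card_K w_prim w0_def; pose c := (w0 - 1)^-1.
have [g' SUg' g'E] :
    exists2 g : gU, g \in SU & mxU g = mxrows 4 (elem_t (- psi * iota c)).
  apply: SU_lift; last exact: det_t.
  apply: unitary_t => //.
  by rewrite exprMn frobeniusN // psi_q frobenius_base mulNr.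
have [h' Gh' lh'] := SU4_lifts SUg'.
rewrite (@commg_eq _ g' (Ugen 4) (Ugen 1)).
  exact: (derived_liftR Gh' (subst_gens_in _) lh' (lifts_subst_gens _)).
apply: (rep_inj mxU_rep).
rewrite !(repM mxU_rep) U4 g'E U1.
have cE : 1 + iota c = iota c * (w * w ^+ q).
  rewrite -iota_w0 -(rmorph1 iota) -rmorphD -rmorphM; congr (iota _).
  by rewrite -[w0 in RHS](subrK 1) mulrDr mulr1 mulVf ?subr_eq0.
have id1 (p k v x : K) : x != 0 -> 1 + k = k * (x * v) ->
    - (x^-1 * p) - x^-1 * (p * k) = - (p * k * v).
  move=> nx e; rewrite -opprD -mulrDr -{1}[p]mulr1 -mulrDr e.
  by congr (- _); field; rewrite nx.
by rows_check; rewrite // (id1 _ _ _ _ w_neq0 cE).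
Qed.

(** z, n = u z^2 and D are products of conjugates of root elements. *)
Lemma derived_lift_gens i : i \in [:: 0; 1; 2; 4; 5]%N -> derived_lift (Ugen i).
Proof.
have [[U0 U1 U2] [U3 U4 U5]] := SU4_gensE.
have ds : derived_lift (Ugen 0) by apply: (@derived_lift_s 1); rewrite U0 expr1n.
have dt := derived_lift_t.
have dz : derived_lift (Ugen 2).
  have -> : Ugen 2 = (Ugen 1 * Ugen 1 ^ Ugen 2 * Ugen 1)%g.
    rewrite conjgE; apply: (rep_inj mxU_rep).
    rewrite !(repM mxU_rep) mxU_zV U1 U2 !mulmxA.
    exact: weyl_z_braid.
  have dtz := derived_liftJ (subst_gens_in _) (lifts_subst_gens (inord 2)) dt.
  exact: (derived_liftM (derived_liftM dt dtz) dt).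
(* n = u z^2 maps e1 to e2 and e2 to -e1. *)
pose n := (Ugen 5 * Ugen 2 ^+ 2)%g.
have nE : mxU n = mxrows 4 (weyl_n 1).
  by rewrite /n expgS expg1 !(repM mxU_rep) U5 U2 mulmxA -weyl_n_uz.
have nVE : mxU n^-1%g = mxrows 4 (weyl_n (-1)).
  by apply: (repV_eq mxU_rep); rewrite nE weyl_nV.
have [h [Gh lh]] : exists h, h \in G /\ lifts n h.
  exists (tnth subst_gens (inord 5) * tnth subst_gens (inord 2) ^+ 2)%g.
  split; first by rewrite groupM ?groupX ?subst_gens_in.
  rewrite /n !(expgS _ 1) !expg1.
  have [l5 l2] := (lifts_subst_gens (inord 5), lifts_subst_gens (inord 2)).
  exact: (liftsM l5 (liftsM l2 l2)).
have def_u : Ugen 5 = (n * (Ugen 2 * Ugen 2)^-1)%g by rewrite /n mulgK.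
move: n nE nVE lh def_u => n nE nVE lh def_u.
have dn : derived_lift n.
  have -> : n = (Ugen 0 * Ugen 0 ^ n * Ugen 0)%g.
    rewrite conjgE; apply: (rep_inj mxU_rep).
    rewrite !(repM mxU_rep) nVE nE U0 !mulmxA.
    exact: weyl_n_braid.
  have dsn := derived_liftJ Gh lh ds.
  exact: (derived_liftM (derived_liftM ds dsn) ds).
have du : derived_lift (Ugen 5).
  rewrite def_u; exact: (derived_liftM dn (derived_liftV (derived_liftM dz dz))).
(* D = n(w^-1) n(1)^-1, where n(x) = s(x) s(x^-1)^n s(x) *)
have dD : derived_lift (Ugen 4).
  have [g1 SUg1 g1E] := SU_lift (unitary_s q_odd frobK w^-1) (det_s _ _).
  have [g2 SUg2 g2E] := SU_lift (unitary_s q_odd frobK w) (det_s _ _).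
  have -> : Ugen 4 = (g1 * g2 ^ n * g1 * n^-1)%g.
    apply: (mulIg n); rewrite mulgKV conjgE.
    apply: (rep_inj mxU_rep).
    rewrite !(repM mxU_rep) nVE nE U4 g1E g2E exprVn !mulmxA.
    exact: torus_weyl_n.
  have d1 := derived_lift_s g1E.
  have d2 := derived_liftJ Gh lh (derived_lift_s g2E).
  have d121 := derived_liftM (derived_liftM d1 d2) d1.
  exact: (derived_liftM d121 (derived_liftV dn)).
by rewrite !inE => /or4P[/eqP->|/eqP->|/eqP->|/orP[/eqP->|/eqP->]].
Qed.

Lemma G_perfect : G \subset G^`(1)%g.
Proof.
have der_gens i : i \in [:: 0; 1; 2; 4; 5]%N ->
    tnth subst_gens (inord i) \in G^`(1)%g.
  move=> /derived_lift_gens[h Gh lh].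
  by rewrite (lifts_inj (lifts_subst_gens (inord i)) lh).
have fE j : fgeval Ogens (tnth (letters 5) (inord j)) = Ogen j.
  exact: fgeval_letter.
have [D0 D1] : Ogen 1 \in G^`(1)%g /\ Ogen 0 \in G^`(1)%g.
  have := der_gens 0%N isT; have := der_gens 1%N isT.
  rewrite !tnth_mktuple !(tnth_nth 1%g subst_letters) !inordK //=.
  by rewrite fgevalV !fE groupV; split.
have [D2 D3 D4] :
    [/\ Ogen 4 \in G^`(1)%g, Ogen 2 \in G^`(1)%g & Ogen 3 \in G^`(1)%g].
  have := der_gens 2%N isT; have := der_gens 4%N isT.
  have := der_gens 5%N isT.
  rewrite !tnth_mktuple !(tnth_nth 1%g subst_letters) !inordK //=.
  rewrite fgevalM fgevalX !fE => h5 h4 h2.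
  by rewrite (groupMr _ (groupX 2 h2)) in h5.
rewrite gen_subG; apply/subsetP => x; rewrite inE => /tnthP[i ->].
have -> : i = inord i by rewrite inord_val.
by case: i => [[|[|[|[|[|//]]]]] lt_i].
Qed.

Let two_neq0F : 2%:R != 0 :> F.
Proof. by rewrite -(fmorph_eq0 iota) rmorph_nat. Qed.

Lemma gen_in_G i : Ogen i \in G.
Proof. by rewrite mem_gen // inE mem_tnth. Qed.

Lemma G_isometry x : x \in G -> minus_isometry w0 (mxO x).
Proof.
pose D := [set x | mxO x *m minus_form w0 *m (mxO x)^T == minus_form w0].
have gD : group_set D.
  apply/group_setP; split=> [|y z]; rewrite !inE.
    by rewrite (rep1 mxO_rep) trmx1 mul1mx mulmx1.
  move=> /eqP isoy /eqP isoz; rewrite (repM mxO_rep) trmx_mul !mulmxA.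
  by rewrite -(mulmxA (mxO y)) -(mulmxA (mxO y)) isoz isoy.
suff /subsetP sGD : G \subset group gD by move/sGD; rewrite inE => /eqP.
have [O0 O1 O2 O3 O4] := Omega_gensE.
rewrite gen_subG; apply/subsetP => _ /[!inE] /tnthP[i ->]; apply/eqP.
rewrite -[i]inord_val; case: i => [[|[|[|[|[|//]]]]] lt_i] /=.
- by rewrite O0; apply: orthogonal_sigma.
- by rewrite O1; apply: orthogonal_tau.
- rewrite O2.
  exact: (orthogonal_delta q_odd card_K w_prim w0_def A_def B_def C_def).
- by rewrite O3; apply: orthogonal_z.
- by rewrite O4; apply: orthogonal_U.
Qed.

Lemma G_tau a b : exists2 x, x \in G & mxO x = mxrows 6 (tau_rows w0 a b).
Proof.
apply: in_G (covers_s psi_neq0 psi2 a b); last exact: det_s.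
set l := _ - _; have -> : - psi * iota b - iota a = l ^+ q.
  rewrite /l frobeniusD // frobeniusN // exprMn psi_q !frobenius_base.
  by rewrite mulNr.
exact: unitary_s.
Qed.

Lemma G_sigma c : exists2 x, x \in G & mxO x = mxrows 6 (sigma_rows c).
Proof.
apply: in_G (covers_t iota psi_neq0 c); last exact: det_t.
by apply: unitary_t => //; rewrite exprMn frobeniusN // psi_q frobenius_base mulNr.
Qed.

Lemma G_d a : a != 0 ->
  exists2 x, x \in G & mxO x = mxrows 6 (torus6 a^-1 a a a^-1 1 0 0 1).
Proof.
move=> na; have nia : iota a != 0 by rewrite fmorph_eq0.
apply: in_G (covers_d iota psi_neq0 na).
  apply: unitary_torus;
  by rewrite // ?exprVn ?frobenius_base ?expr1n ?mulr1 ?mulVf ?mulfV.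
by rewrite det_torus4 mulVf // !mulr1.
Qed.

(** The torus element of l = a + b psi, whose norm is N. *)
Lemma G_torus a b (N := a ^+ 2 - w0 * b ^+ 2) : N != 0 ->
  exists2 x, x \in G & mxO x =
    mxrows 6 (torus6 N^-1 N 1 1 ((a ^+ 2 + w0 * b ^+ 2) / N)
      (- (2%:R * a * b) / N) (- (2%:R * w0 * a * b) / N)
      ((a ^+ 2 + w0 * b ^+ 2) / N)).
Proof.
move=> nN; pose l := iota a + psi * iota b; pose l' := iota a - psi * iota b.
have lq : l ^+ q = l' := frobenius_pair q_odd card_K w_prim w0_def a b.
have l'q : l' ^+ q = l by rewrite -lq frobK.
have : l * l' != 0.
  rewrite (_ : l * l' = iota N) ?fmorph_eq0 //.
  by rewrite /N rmorphB rmorphXn rmorphM rmorphXn -psi2 /l /l'; ring.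
rewrite mulf_eq0 negb_or => /andP[nl nl'].
apply: in_G (covers_D psi_neq0 psi2 nl nl').
  by apply: unitary_torus; rewrite // ?exprVn ?lq ?l'q ?mulVf ?mulfV.
by rewrite det_torus4 mulrAC mulfK // mulVf.
Qed.

Lemma G_eq_derived_SO (SO : {group gO}) :
  (forall x, reflect (minus_isometry w0 (mxO x) /\ \det (mxO x) = 1) (x \in SO)) ->
  G :=: [~: SO, SO]%g.
Proof.
move=> SO_P; have sGSO : G \subset SO.
  apply/subsetP => x Gx; apply/SO_P; split; first exact: G_isometry.
  exact: det_perfect mxO_rep G_perfect x Gx.
apply/eqP; rewrite eqEsubset; apply/andP; split.
  by apply: subset_trans G_perfect _; rewrite derg1 commgSS.
have [_ _ _ O3 O4] := Omega_gensE.
apply: (derived_SO_sub w0_neq0 two_neq0F _ _ mxO_rep G_isometry G_sigma G_tau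
          _ _ G_d G_torus SO_P sGSO).
- exact: (norm_form_eq0 q_odd card_K w_prim w0_def).
- exact: (w0_generates q_odd card_K w_prim w0_def).
- by exists (Ogen 3); rewrite ?gen_in_G.
- by exists (Ogen 4); rewrite ?gen_in_G.
Qed.

End Isomorphism.

(** * The special orthogonal group and the presentation *)

Lemma SOminus6P (F : finFieldType) (w0 : F) (g : {'GL_6[F]}) :
  reflect (minus_isometry w0 (GLval g) /\ \det (GLval g) = 1) (g \in SOminus6 w0).
Proof. by rewrite inE; apply: (iffP andP) => -[/eqP ? /eqP]. Qed.

Lemma SOminus6_group_set (F : finFieldType) (w0 : F) : group_set (SOminus6 w0).
Proof.
have rep := @GLval_faithful F 6.
apply/group_setP; split=> [|x y /SOminus6P[isox dx] /SOminus6P[isoy dy]];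
  apply/SOminus6P.
  by rewrite (rep1 rep) det1 /minus_isometry trmx1 mul1mx mulmx1.
rewrite (repM rep) det_mulmx dx dy mulr1; split=> //.
rewrite /minus_isometry trmx_mul !mulmxA.
by rewrite -(mulmxA (GLval x)) -(mulmxA (GLval x)) isoy.
Qed.

Theorem theorem11p1
  (F K : finFieldType) (iota : {rmorphism F -> K})
  (q_odd : odd #|F|) (card_K : #|K| = (#|F| ^ 2)%N)
  (w : K) (w_prim : primitive_element w)
  (w0 A B C : F) (m : int)
  (psi := w ^+ (#|F|.+1)./2)
  (w0_def : iota w0 = w ^+ #|F|.+1)
  (A_def : iota A = (w ^+ #|F|.-1 + w ^- #|F|.-1) / 2%:R)
  (B_def : iota B = psi * (w ^- #|F|.-1 - w ^+ #|F|.-1) / 2%:R)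
  (C_def : iota C = psi^-1 * (w ^- #|F|.-1 - w ^+ #|F|.-1) / 2%:R)
  (m_def : #|F| <> 3%N -> iota w0 ^ m = w ^+ 2 + w ^+ (2 * #|F|))
  (RSL RPSL : freegroup 'I_3 -> Prop)
  (RSL_pres : presents RSL (SL2 F) (SL2_gens w0))
  (RPSL_pres : presents RPSL (PSL2 K) (PSL2_gens w))
  (SU4_pres : presents (SU4_relators #|F| m RSL RPSL)
                (SU4_mod #|F| K) (SU4_mod_gens #|F| w)) :
  presents (image_rel subst (SU4_relators #|F| m RSL RPSL))
    (Omegaminus6 w0) (Omega_gens w0 A B C).
Proof.
have repO := @GLval_faithful F 6; have repU := @GLval_faithful K 4.
have OE := Omega_gensE q_odd card_K w_prim w0_def A_def B_def C_def.
have UE := SU4_gensE q_odd card_K w_prim w0_def.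
have lift := @SU4_lift #|F| K.
split.
  exact: (G_eq_derived_SO q_odd card_K w_prim w0_def A_def B_def C_def repO repU
            OE UE (negI4E K) lift SU4_pres
            (SO := Group (SOminus6_group_set w0)) (SOminus6P w0)).
exact: (Omega_relP q_odd card_K w_prim w0_def A_def B_def C_def repO repU
          OE UE (negI4E K) SU4_pres).
Qed.
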